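(* Let $A$ be a unital $C^*$-algebra, let $S$ be a cancellative left Ore monoid with enveloping group $G=S^{-1}S$, and let $\alpha: S\rightarrow \mathrm{Endr}(A)$ be an action of $S$ on $A$ by injective unital $*$-homomorphisms. Then $$A\times_{\alpha}S=(S^*AS)\times_{\overline{\alpha}}G$$ via an $S$-equivariant $*$-isomorphism.
   Context: An action of a (discrete) monoid $S$ on a unital $C^*$-algebra $A$ by $*$-homomorphisms is a monoid homomorphism $\alpha$, $s\mapsto\alpha_s$, into the monoid of $*$-endomorphisms of $A$. A monoid $S$ is left Ore if for all $s,t\in S$ there are $\hat s,\hat t\in S$ with $\hat s t=\hat t s$. A cancellative left Ore monoid embeds in its group of left fractions (enveloping group) $G=S^{-1}S$. Semigroup crossed product: a covariant representation of $(A,S,\alpha)$ is a pair $(\pi,V)$, with $\pi$ a unital representation of $A$ on a Hilbert space $H$, and $V: S\to\mathrm{Isom}(H)$ satisfying $V_sV_t=V_{st}$ and $\pi(\alpha_t(a))=V_t\pi(a)V_t^*$ for all $a\in A$, $s,t\in S$. $A\times_\alpha S$ is the $C^*$-algebra with a unital homomorphism $i_A: A\to A\times_\alpha S$ and a representation $i_S$ of $S$ by isometries in $A\times_\alpha S$, such that $(i_A,i_S)$ is covariant, every covariant representation $(\pi,V)$ factors as $\pi=(\pi\times V)\circ i_A$, $V=(\pi\times V)\circ i_S$ for a representation $\pi\times V$ of $A\times_\alpha S$, and $i_A(A)\cup i_S(S)$ generates $A\times_\alpha S$ as a $C^*$-algebra. $A$ is identified with $i_A(A)$. $S^*AS$ is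 the norm closure in $A\times_\alpha S$ of $\{i_S(s)^*i_A(a)i_S(s): s\in S, a\in A\}$; it is a unital $C^*$-subalgebra containing $A$, and $S$ acts on it by $\overline\alpha_t(x)=i_S(t)\,x\,i_S(t)^*$. When the $\alpha_s$ are unital, the $\overline\alpha_t$ are automorphisms of $S^*AS$, and $\overline\alpha$ also denotes the resulting action of $G$, $\overline\alpha_{s^{-1}t}=\overline\alpha_s^{-1}\overline\alpha_t$. $(S^*AS)\times_{\overline\alpha}G$ is the group $C^*$-crossed product, with canonical unitaries $u_g$ implementing $\overline\alpha$. A $*$-isomorphism $\Phi: A\times_\alpha S\to (S^*AS)\times_{\overline\alpha}G$ is $S$-equivariant if it intertwines the canonical actions of $S$: $\Phi(i_S(s)\,x\,i_S(s)^* )=u_s\Phi(x)u_s^*$. *)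

(* Defs.v *)
From HB Require Import structures.
From mathcomp Require Import all_boot all_order all_algebra.
From mathcomp Require Import sesquilinear.
From mathcomp Require Import all_classical all_reals all_analysis.
From mathcomp Require Export complex.

Set Implicit Arguments.
Unset Strict Implicit.
Unset Printing Implicit Defensive.

Import Order.TTheory GRing.Theory Num.Theory.
Import numFieldNormedType.Exports.

Local Open Scope classical_set_scope.
Local Open Scope ring_scope.

(* Unital C*-algebras, the zero algebra included. The norm of a
   [completeNormedModType K] takes its values in [K]; for [K = R[i]] these
   values are nonnegative, hence real.
   This is a plain record rather than an HB structure because MathComp's
   hierarchy has no join of rings and normed modules below [numDomainType]. *)
Record cstarType (K : numClosedFieldType) := CStarAlgebra {
  cstar_normedMod : completeNormedModType K;
  cstar_one : cstar_normedMod;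
  cstar_mul : cstar_normedMod -> cstar_normedMod -> cstar_normedMod;
  cstar_star : cstar_normedMod -> cstar_normedMod;
  cstar_mulA : associative cstar_mul;
  cstar_mul1 : left_id cstar_one cstar_mul;
  cstar_mulr1 : right_id cstar_one cstar_mul;
  cstar_mulDl : left_distributive cstar_mul +%R;
  cstar_mulDr : right_distributive cstar_mul +%R;
  cstar_mulZl : forall (k : K) x y, cstar_mul (k *: x) y = k *: cstar_mul x y;
  cstar_mulZr : forall (k : K) x y, cstar_mul x (k *: y) = k *: cstar_mul x y;
  cstar_normM : forall x y, `|cstar_mul x y| <= `|x| * `|y|;
  cstar_starK : involutive cstar_star;
  cstar_starD : {morph cstar_star : x y / x + y};
  cstar_starM : forall x y,
    cstar_star (cstar_mul x y) = cstar_mul (cstar_star y) (cstar_star x);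
  cstar_starZ : forall (k : K) x, cstar_star (k *: x) = k^* *: cstar_star x;
  cstar_identity : forall x, `|cstar_mul (cstar_star x) x| = `|x| ^+ 2
}.

Definition cstar_sort (K : numClosedFieldType) (A : cstarType K) : Type :=
  cstar_normedMod A.
Coercion cstar_sort : cstarType >-> Sortclass.

Section CStarInstances.
Variables (K : numClosedFieldType) (A : cstarType K).

HB.instance Definition _ :=
  CompleteNormedModule.copy (cstar_sort A) (cstar_normedMod A).

HB.instance Definition _ := GRing.Zmodule_isPzRing.Build (cstar_sort A)
  (@cstar_mulA K A) (@cstar_mul1 K A) (@cstar_mulr1 K A)
  (@cstar_mulDl K A) (@cstar_mulDr K A).

Definition star (x : A) : A := cstar_star x.

End CStarInstances.

Section CStarTheory.
Variables (K : numClosedFieldType) (A : cstarType K).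
Implicit Types (x y : A) (k : K) (E X : set A).

Lemma csMZl k x y : (k *: x) * y = k *: (x * y).
Proof. exact: cstar_mulZl. Qed.
Lemma csMZr k x y : x * (k *: y) = k *: (x * y).
Proof. exact: cstar_mulZr. Qed.
Lemma cs_normM x y : `|x * y| <= `|x| * `|y|.
Proof. exact: cstar_normM. Qed.
Lemma csK : involutive (@star K A).
Proof. exact: cstar_starK. Qed.
Lemma csD : {morph @star K A : x y / x + y}.
Proof. exact: cstar_starD. Qed.
Lemma csM x y : star (x * y) = star y * star x.
Proof. exact: cstar_starM. Qed.
Lemma csZ k x : star (k *: x) = k^* *: star x.
Proof. exact: cstar_starZ. Qed.
Lemma cs_identity x : `|star x * x| = `|x| ^+ 2.
Proof. exact: cstar_identity. Qed.

Definition star_subalgebra E : Prop :=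
  [/\ E 1,
      forall k x y, E x -> E y -> E (k *: x + y),
      forall x y, E x -> E y -> E (x * y) &
      forall x, E x -> E (star x)].

Definition cstar_generates X : Prop :=
  forall E, star_subalgebra E -> closed E -> X `<=` E -> E = setT.

End CStarTheory.

Definition is_star_hom (K : numClosedFieldType) (A B : cstarType K)
    (f : A -> B) : Prop :=
  [/\ linear f, {morph f : x y / x * y} & {morph f : x / star x}].

HB.mixin Record NormedModule_isHilbert (K : numClosedFieldType) H
    of CompleteNormedModule K H := {
  dotp : {dot H for (@Num.conj K)};
  dotp_norm : forall x : H, dotp x x = `|x| ^+ 2
}.

#[short(type="hilbertType")]
HB.structure Definition Hilbert (K : numClosedFieldType) :=
  {H of CompleteNormedModule K H & NormedModule_isHilbert K H}.

Section Operators.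
Variables (K : numClosedFieldType) (H : hilbertType K).
Implicit Types T V : {linear H -> H}.

Definition is_adjoint (T T' : H -> H) : Prop :=
  forall x y : H, dotp (T x) y = dotp x (T' y).

Definition is_isometry (V : H -> H) : Prop := forall x : H, `|V x| = `|x|.

Definition is_unitary (V : H -> H) : Prop :=
  is_isometry V /\ forall y, exists x, V x = y.

(* Unital *-homomorphisms from [A] to the bounded operators on [H]. *)
Record is_unital_rep (A : cstarType K) (pi : A -> {linear H -> H}) : Prop := {
  rep_continuous : forall a, continuous (pi a);
  rep_linear : forall (k : K) (a b : A) x, pi (k *: a + b) x = k *: pi a x + pi b x;
  rep_mul : forall (a b : A) x, pi (a * b) x = pi a (pi b x);
  rep_one : forall x, pi 1 x = x;
  rep_star : forall a : A, is_adjoint (pi a) (pi (star a))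
}.

End Operators.

Definition is_action (K : numClosedFieldType) (S : monoidType) (A : cstarType K)
    (alpha : S -> A -> A) : Prop :=
  [/\ forall s, is_star_hom (alpha s),
      forall a, alpha 1%g a = a &
      forall s t a, alpha (s * t)%g a = alpha s (alpha t a)].

Definition unital_action (K : numClosedFieldType) (S : monoidType)
    (A : cstarType K) (alpha : S -> A -> A) : Prop :=
  forall s, alpha s 1 = 1.

Section SemigroupCrossedProduct.
Variables (K : numClosedFieldType) (S : monoidType) (A : cstarType K).
Variable alpha : S -> A -> A.

(* The adjoint [W] of [V t] exists and is unique, by the Riesz representation
   theorem. *)
Record is_covariant_rep (H : hilbertType K) (pi : A -> {linear H -> H})
    (V : S -> {linear H -> H}) : Prop := {
  cov_rep : is_unital_rep pi;
  cov_isometry : forall t, is_isometry (V t);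
  cov_mul : forall s t x, V (s * t)%g x = V s (V t x);
  cov_conj : forall t, exists2 W : H -> H, is_adjoint (V t) W &
    forall a x, pi (alpha t a) x = V t (pi a (W x))
}.

Record is_crossed_product (B : cstarType K) (iA : A -> B) (iS : S -> B) : Prop := {
  cp_hom : is_star_hom iA;
  cp_unital : iA 1 = 1;
  cp_isometry : forall t, star (iS t) * iS t = 1;
  cp_mul : forall s t, iS (s * t)%g = iS s * iS t;
  cp_conj : forall t a, iA (alpha t a) = iS t * iA a * star (iS t);
  cp_universal : forall (H : hilbertType K) (pi : A -> {linear H -> H})
      (V : S -> {linear H -> H}), is_covariant_rep pi V ->
    exists rho : B -> {linear H -> H}, [/\ is_unital_rep rho,
      forall a x, rho (iA a) x = pi a x & forall s x, rho (iS s) x = V s x];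
  cp_generates : cstar_generates (range iA `|` range iS)
}.

End SemigroupCrossedProduct.

Section GroupCrossedProduct.
Variables (K : numClosedFieldType) (G : groupType) (D : cstarType K).
Variable beta : G -> D -> D.

Record is_group_covariant_rep (H : hilbertType K) (pi : D -> {linear H -> H})
    (U : G -> {linear H -> H}) : Prop := {
  gcov_rep : is_unital_rep pi;
  gcov_unitary : forall g, is_unitary (U g);
  gcov_mul : forall g h x, U (g * h)%g x = U g (U h x);
  gcov_conj : forall g, exists2 W : H -> H, is_adjoint (U g) W &
    forall d x, pi (beta g d) x = U g (pi d (W x))
}.

(* For a discrete group and a unital C*-algebra, the full crossed product
   together with its canonical embeddings is characterized by its universal
   property for covariant pairs. *)
Record is_group_crossed_product (C : cstarType K) (iD : D -> C) (u : G -> C)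
    : Prop := {
  gcp_hom : is_star_hom iD;
  gcp_unital : iD 1 = 1;
  gcp_unitary : forall g, star (u g) * u g = 1 /\ u g * star (u g) = 1;
  gcp_mul : forall g h, u (g * h)%g = u g * u h;
  gcp_conj : forall g d, iD (beta g d) = u g * iD d * star (u g);
  gcp_universal : forall (H : hilbertType K) (pi : D -> {linear H -> H})
      (U : G -> {linear H -> H}), is_group_covariant_rep pi U ->
    exists rho : C -> {linear H -> H}, [/\ is_unital_rep rho,
      forall d x, rho (iD d) x = pi d x & forall g x, rho (u g) x = U g x];
  gcp_generates : cstar_generates (range iD `|` range u)
}.

End GroupCrossedProduct.

Definition cancellative (S : monoidType) : Prop :=
  @left_injective S S S *%g /\ @right_injective S S S *%g.

Definition left_ore (S : monoidType) : Prop :=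
  forall s t : S, exists s' t' : S, (s' * t = t' * s)%g.

(* [iota] realizes [G] as the group of left fractions S^-1 S. *)
Record is_enveloping_group (S : monoidType) (G : groupType) (iota : S -> G)
    : Prop := {
  env_one : iota 1%g = 1%g;
  env_mul : {morph iota : s t / (s * t)%g};
  env_inj : injective iota;
  env_frac : forall g, exists s t, g = ((iota s)^-1 * iota t)%g
}.

Section Continuity.
Variables (K : numClosedFieldType) (A : cstarType K).

Lemma cs_lipschitz_continuous (f : A -> A) (M : K) : 0 <= M ->
  (forall x y, `|f x - f y| <= M * `|x - y|) -> continuous f.
Proof.
move=> M0 Hf x.
have M1 : 0 < M + 1 by rewrite ltr_wpDl.
apply/cvgrPdist_lt => e e0; near=> y.
apply: (le_lt_trans (Hf x y)).
have : `|x - y| < e / (M + 1).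
  by near: y; apply: cvgr_dist_lt; [exact: cvg_id|rewrite divr_gt0].
rewrite ltr_pdivlMr// mulrC => h; apply: le_lt_trans h.
by rewrite ler_wpM2r// lerDl.
Unshelve. all: by end_near. Qed.

Lemma cs_norm_star (x : A) : `|star x| = `|x|.
Proof.
suff le_star (y : A) : `|y| <= `|star y|.
  by apply/eqP; rewrite eq_le -{2}(csK x) !le_star.
case: (eqVneq `|y| 0) => [->//|nz].
have y0 : 0 < `|y| by rewrite lt_def nz normr_ge0.
by rewrite -(ler_pM2r y0) -expr2 -cs_identity cs_normM.
Qed.

Lemma cs_addl_continuous (y : A) : continuous (fun x : A => y + x).
Proof.
apply: (cs_lipschitz_continuous (M := 1)) => // x z.
by rewrite mul1r opprD addrACA subrr add0r.
Qed.

Lemma cs_mull_continuous (y : A) : continuous (fun x : A => y * x).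
Proof.
by apply: (cs_lipschitz_continuous (M := `|y|)) => // x z; rewrite -mulrBr cs_normM.
Qed.

Lemma cs_mulr_continuous (y : A) : continuous (fun x : A => x * y).
Proof.
apply: (cs_lipschitz_continuous (M := `|y|)) => // x z.
by rewrite -mulrBl mulrC cs_normM.
Qed.

Lemma cs_scale_continuous (k : K) : continuous (fun x : A => k *: x).
Proof.
by apply: (cs_lipschitz_continuous (M := `|k|)) => // x z; rewrite -scalerBr normrZ.
Qed.

Lemma cs_starN (x : A) : star (- x) = - star x.
Proof. by rewrite -scaleN1r csZ rmorphN1 scaleN1r. Qed.

Lemma cs_star_continuous : continuous (@star K A).
Proof.
apply: (cs_lipschitz_continuous (M := 1)) => // x z.
by rewrite mul1r -cs_starN -csD cs_norm_star.
Qed.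

Lemma closure_stable (X Y : set A) (f : A -> A) : continuous f -> closed Y ->
  (forall x, X x -> Y (f x)) -> forall x, closure X x -> Y (f x).
Proof.
move=> cf cY XY x; have cP : closed (f @^-1` Y) by apply: closed_comp => // *; exact: cf.
by move=> /(closureS (B := f @^-1` Y) XY); rewrite -(proj1 (closure_id _) cP).
Qed.

Lemma closure_star_subalgebra (X : set A) :
  star_subalgebra X -> star_subalgebra (closure X).
Proof.
case=> X1 XD XM XS; have cX := @closed_closure _ X.
have sX := @subset_closure _ X.
have clo := @closure_stable X (closure X).
split.
- exact: sX.
- move=> k x y Xx Xy.
  apply: (clo (fun z => k *: x + z)) Xy => //; first exact: cs_addl_continuous.
  move=> z Xz; move: x Xx; apply: clo => // [|x Xx]; last exact/sX/XD.
  by apply: (cs_lipschitz_continuous (M := `|k|)) => // w v;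
    rewrite opprD addrACA subrr addr0 -scalerBr normrZ.
- move=> x y Xx Xy.
  apply: (clo (fun z => x * z)) Xy => //; first exact: cs_mull_continuous.
  move=> z Xz; move: x Xx; apply: clo => // [|x Xx]; last exact/sX/XM.
  exact: cs_mulr_continuous.
- apply: clo => // [|x Xx]; last exact/sX/XS.
  exact: cs_star_continuous.
Qed.

End Continuity.

Record cstarSubalg (K : numClosedFieldType) (B : cstarType K) := CStarSubalg {
  csub_set : set B;
  csub_subalgebra : star_subalgebra csub_set;
  csub_closed : closed csub_set
}.

Section SubCStar.
Variables (K : numClosedFieldType) (B : cstarType K) (E : cstarSubalg B).

Definition csub_pred : {pred B} := fun x => `[< csub_set E x >].

Record csub_type : Type := CSub { csub_val : B; _ : csub_val \in csub_pred }.

HB.instance Definition _ := [isSub for csub_val].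
HB.instance Definition _ := [Choice of csub_type by <:].

Lemma csub_pred_submod : GRing.subsemimod_closed csub_pred.
Proof.
case: (csub_subalgebra E) => E1 ED EM ES.
have E0 : csub_set E 0 by have := ED (-1) 1 1 E1 E1; rewrite scaleN1r addNr.
split; first split.
- exact/asboolP.
- move=> x y /asboolP Ex /asboolP Ey; apply/asboolP.
  by rewrite -[x]scale1r; exact: ED.
- move=> k x /asboolP Ex; apply/asboolP.
  by rewrite -[_ *: _]addr0; exact: ED.
Qed.

HB.instance Definition _ :=
  GRing.SubChoice_isSubLmodule.Build K B csub_pred csub_type csub_pred_submod.

Let csub_norm (x : csub_type) : K := `|csub_val x|.

Let csub_normD x y : csub_norm (x + y) <= csub_norm x + csub_norm y.
Proof. exact: ler_normD. Qed.

Let csub_normZ k x : csub_norm (k *: x) = `|k| * csub_norm x.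
Proof. by rewrite /csub_norm -normrZ. Qed.

Let csub_norm0 x : csub_norm x = 0 -> x = 0.
Proof. by move=> /normr0_eq0 x0; apply/val_inj. Qed.

HB.instance Definition _ :=
  Lmodule_isNormed.Build K csub_type csub_normD csub_normZ csub_norm0.

Let csub_complete (F : set_system csub_type) :
  ProperFilter F -> cauchy F -> cvg F.
Proof.
move=> FF /cauchyP cF.
have PF : ProperFilter (csub_val @ F) by exact: fmap_proper_filter.
have cG : cauchy (csub_val @ F).
  apply/cauchyP => e e0; have [x Fx] := cF e e0; exists (csub_val x).
  by move: Fx; rewrite -!ball_normE.
have : cvg (csub_val @ F) by apply: cauchy_cvg.
move=> /cvg_ex[l Gl].
have El : csub_set E l.
  have EF : \forall x \near F, csub_set E (csub_val x).
    by apply: nearW => x; apply/asboolP; exact: (valP x).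
  exact: (closed_cvg (csub_set E) (@csub_closed _ _ E) EF l Gl).
have lE : l \in csub_pred by exact/asboolP.
apply/cvg_ex; exists (CSub lE).
apply/cvgrPdist_lt => e e0.
by move/cvgrPdist_lt : Gl => /(_ e e0).
Qed.

HB.instance Definition _ := Uniform_isComplete.Build csub_type csub_complete.

Let csub1 : 1 \in csub_pred.
Proof. by apply/asboolP; case: (csub_subalgebra E). Qed.
Let csubM (x y : csub_type) : csub_val x * csub_val y \in csub_pred.
Proof.
apply/asboolP; case: (csub_subalgebra E) => _ _ EM _.
by apply: EM; apply/asboolP; exact: (valP (_ : csub_type)).
Qed.
Let csubS (x : csub_type) : star (csub_val x) \in csub_pred.
Proof.
apply/asboolP; case: (csub_subalgebra E) => _ _ _ ES.
by apply: ES; apply/asboolP; exact: (valP (_ : csub_type)).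
Qed.

Let csub_eq (x y : csub_type) : csub_val x = csub_val y -> x = y.
Proof. by move=> xy; apply/val_inj. Qed.

Definition csub_cstar : cstarType K.
Proof.
apply: (@CStarAlgebra K csub_type (CSub csub1)
  (fun x y => CSub (csubM x y)) (fun x => CSub (csubS x))).
- by move=> x y z; apply: csub_eq; rewrite /= mulrA.
- by move=> x; apply: csub_eq; rewrite /= mul1r.
- by move=> x; apply: csub_eq; rewrite /= mulr1.
- by move=> x y z; apply: csub_eq; rewrite /= mulrDl.
- by move=> x y z; apply: csub_eq; rewrite /= mulrDr.
- by move=> k x y; apply: csub_eq; rewrite /= csMZl.
- by move=> k x y; apply: csub_eq; rewrite /= csMZr.
- by move=> x y; exact: cs_normM.
- by move=> x; apply: csub_eq; rewrite /= csK.
- by move=> x y; apply: csub_eq; rewrite /= csD.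
- by move=> x y; apply: csub_eq; rewrite /= csM.
- by move=> k x; apply: csub_eq; rewrite /= csZ.
- by move=> x; exact: cs_identity.
Defined.

Definition csub_incl (x : csub_cstar) : B := csub_val x.

Lemma csub_inclP (x : csub_cstar) : csub_set E (csub_incl x).
Proof. by apply/asboolP; exact: (valP (x : csub_type)). Qed.

Definition csub_mk (x : B) (Ex : csub_set E x) : csub_cstar :=
  CSub (asboolT Ex : x \in csub_pred).

End SubCStar.

Section SstarAS.
Variables (K : numClosedFieldType) (S : monoidType) (A B : cstarType K).
Variables (alpha : S -> A -> A) (iA : A -> B) (iS : S -> B).

Definition SAS_set : set B :=
  closure [set x | exists s a, x = star (iS s) * iA a * iS s].

Hypothesis hO : left_ore S.
Hypothesis hun : unital_action alpha.
Hypothesis hB : is_crossed_product alpha iA iS.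

Lemma iS_isometry t : star (iS t) * iS t = 1.
Proof. exact: cp_isometry hB t. Qed.

Lemma iS_coisometry t : iS t * star (iS t) = 1.
Proof.
by have := cp_conj hB t 1; rewrite hun (cp_unital hB) mulr1 => <-.
Qed.

Lemma iS_mul s t : iS (s * t)%g = iS s * iS t.
Proof. exact: cp_mul hB s t. Qed.

Lemma iA_star a : iA (star a) = star (iA a).
Proof. by case: (cp_hom hB). Qed.

Lemma iA_mul a b : iA (a * b) = iA a * iA b.
Proof. by case: (cp_hom hB). Qed.

Lemma cs_star1 : star 1 = 1 :> B.
Proof. by rewrite -[LHS]mul1r -{1}[1]csK -csM mul1r csK. Qed.

Lemma iS_refine r s a : star (iS s) * iA a * iS s =
  star (iS (r * s)%g) * iA (alpha r a) * iS (r * s)%g.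
Proof.
rewrite iS_mul csM (cp_conj hB) !mulrA.
rewrite -[star (iS s) * star (iS r) * iS r]mulrA iS_isometry mulr1.
by rewrite -[_ * star (iS r) * iS r]mulrA iS_isometry mulr1.
Qed.

Lemma SAS_subalgebra : star_subalgebra SAS_set.
Proof.
apply: closure_star_subalgebra.
have common x y : (exists s a, x = star (iS s) * iA a * iS s) ->
    (exists s a, y = star (iS s) * iA a * iS s) ->
    exists r a b, x = star (iS r) * iA a * iS r /\
      y = star (iS r) * iA b * iS r.
  move=> [s [a ->]] [t [b ->]]; have [s' [t' e]] := hO s t.
  exists (t' * s)%g, (alpha t' a), (alpha s' b); split; first exact: iS_refine.
  by rewrite -e; exact: iS_refine.
split.
- by exists 1%g, 1; rewrite (cp_unital hB) mulr1 iS_isometry.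
- move=> k x y xX yX; have [r [a [b [-> ->]]]] := common _ _ xX yX.
  exists r, (k *: a + b); have [-> _ _] := cp_hom hB.
  by rewrite mulrDr mulrDl csMZr csMZl.
- move=> x y xX yX; have [r [a [b [-> ->]]]] := common _ _ xX yX.
  exists r, (a * b); rewrite iA_mul !mulrA.
  by rewrite -[_ * iS r * star (iS r)]mulrA iS_coisometry mulr1.
- move=> x [s [a ->]]; exists s, (star a).
  by rewrite iA_star !csM csK mulrA.
Qed.

Definition SAS_subalg : cstarSubalg B :=
  CStarSubalg SAS_subalgebra (@closed_closure _ _).

Definition SAS : cstarType K := csub_cstar SAS_subalg.

Lemma SAS_conj t (x : B) : SAS_set x -> SAS_set (iS t * x * star (iS t)).
Proof.
apply: (@closure_stable K B _ _ (fun x => iS t * x * star (iS t))) x.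
- apply: (cs_lipschitz_continuous (M := `|iS t| * `|star (iS t)|)).
    by rewrite mulr_ge0.
  move=> x y; rewrite -mulrBl -mulrBr; apply: le_trans (cs_normM _ _) _.
  by rewrite mulrAC ler_wpM2r// cs_normM.
- exact: closed_closure.
- move=> _ [s [a ->]]; apply: subset_closure.
  have [s' [t' e]] := hO s t.
  exists s', (alpha t' a).
  have q : star (iS s') * iS t' = iS t * star (iS s).
    have := congr1 (fun z => star (iS s') * z * star (iS s)) (iS_mul t' s).
    rewrite -e iS_mul !mulrA iS_isometry mul1r => ->.
    by rewrite -[_ * iS s * _]mulrA iS_coisometry mulr1.
  rewrite (cp_conj hB) !mulrA q.
  have -> : iS t * star (iS s) * iA a * star (iS t') * iS s' =
    iS t * star (iS s) * iA a * star (star (iS s') * iS t') by rewrite csM csK !mulrA.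
  by rewrite q csM csK !mulrA.
Qed.

Lemma SAS_conjV t (x : B) : SAS_set x -> SAS_set (star (iS t) * x * iS t).
Proof.
apply: (@closure_stable K B _ _ (fun x => star (iS t) * x * iS t)) x.
- apply: (cs_lipschitz_continuous (M := `|star (iS t)| * `|iS t|)).
    by rewrite mulr_ge0.
  move=> x y; rewrite -mulrBl -mulrBr; apply: le_trans (cs_normM _ _) _.
  by rewrite mulrAC ler_wpM2r// cs_normM.
- exact: closed_closure.
- move=> _ [s [a ->]]; apply: subset_closure.
  by exists (s * t)%g, a; rewrite iS_mul csM !mulrA.
Qed.

Definition alphabar (t : S) (x : SAS) : SAS :=
  @csub_mk K B SAS_subalg _ (SAS_conj (t := t) (csub_inclP x)).

Definition alphabar_inv (t : S) (x : SAS) : SAS :=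
  @csub_mk K B SAS_subalg _ (SAS_conjV (t := t) (csub_inclP x)).

Lemma csub_incl_inj (x y : SAS) : csub_incl x = csub_incl y -> x = y.
Proof. exact: (@val_inj _ _ (csub_type SAS_subalg)). Qed.

Lemma alphabarK t : cancel (alphabar t) (alphabar_inv t).
Proof.
move=> x; apply: csub_incl_inj; rewrite /csub_incl /= !mulrA iS_isometry mul1r.
by rewrite -mulrA iS_isometry mulr1.
Qed.

Lemma alphabarVK t : cancel (alphabar_inv t) (alphabar t).
Proof.
move=> x; apply: csub_incl_inj; rewrite /csub_incl /= !mulrA iS_coisometry mul1r.
by rewrite -mulrA iS_coisometry mulr1.
Qed.

Variables (G : groupType) (iota : S -> G).
Hypothesis hG : is_enveloping_group iota.

(* [alphabarG (s^-1 t) = alphabar_s^-1 alphabar_t]; the definition picks a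
   representation of [g] as a fraction, and [alphabarG_frac] shows that the
   choice is immaterial. *)
Definition alphabarG (g : G) (x : SAS) : SAS :=
  let s := projT1 (cid (env_frac hG g)) in
  let t := projT1 (cid (projT2 (cid (env_frac hG g)))) in
  alphabar_inv s (alphabar t x).

Lemma alphabarG_frac s t x :
  alphabarG ((iota s)^-1 * iota t)%g x = alphabar_inv s (alphabar t x).
Proof.
rewrite /alphabarG.
case: cid => s1 /= ?; case: cid => t1 /= e.
have [p [q e1]] := hO s1 s.
have e2 : (p * t = q * t1)%g.
  apply: (env_inj hG); rewrite !(env_mul hG).
  have -> : iota t = (iota s * ((iota s)^-1 * iota t))%g by rewrite mulVKg.
  by rewrite e !mulgA -(env_mul hG p s) e1 (env_mul hG q s1) mulgK.
have frac u v w : star (iS u) * iS v = star (iS (w * u)%g) * iS (w * v)%g.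
  by rewrite !iS_mul csM !mulrA -[_ * star (iS w) * iS w]mulrA iS_isometry mulr1.
have fe : star (iS s1) * iS t1 = star (iS s) * iS t.
  by rewrite (frac s t p) (frac s1 t1 q) e1 e2.
have fe' : star (iS t1) * iS s1 = star (iS t) * iS s.
  by have := congr1 (@star _ _) fe; rewrite !csM !csK.
apply: csub_incl_inj; rewrite /csub_incl /= !mulrA fe.
by rewrite -[LHS]mulrA -[RHS]mulrA fe'.
Qed.

Lemma alphabarG_iota s x : alphabarG (iota s) x = alphabar s x.
Proof.
have -> : iota s = ((iota 1)^-1 * iota s)%g by rewrite (env_one hG) invg1 mul1g.
rewrite alphabarG_frac.
have e : iS 1%g = 1.
  have := congr1 (fun z => star (iS 1%g) * z) (iS_mul 1 1).
  by rewrite mulg1 mulrA iS_isometry mul1r.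
by apply: csub_incl_inj; rewrite /csub_incl /= e cs_star1 mul1r mulr1.
Qed.

Lemma alphabar_mul s t x : alphabar (s * t)%g x = alphabar s (alphabar t x).
Proof.
by apply: csub_incl_inj; rewrite /csub_incl /= iS_mul csM !mulrA.
Qed.

Lemma alphabarG_is_action : is_action alphabarG.
Proof.
have starhom t : is_star_hom (alphabar t).
  split.
  - move=> k x y; apply: csub_incl_inj; rewrite /csub_incl /=.
    by rewrite mulrDr mulrDl csMZr csMZl.
  - move=> x y; apply: csub_incl_inj; rewrite /csub_incl /= !mulrA.
    by rewrite -[_ * star (iS t) * iS t]mulrA iS_isometry mulr1.
  - by move=> x; apply: csub_incl_inj; rewrite /csub_incl /= !csM csK mulrA.
split.
- move=> g; have [s [t ->]] := env_frac hG g.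
  have [l m st] := starhom t; have [l' m' st'] := starhom s.
  split=> [k x y|x y|x]; rewrite !alphabarG_frac; apply: (can_inj (alphabarK s)).
  + by rewrite l' !alphabarVK l.
  + by rewrite m' !alphabarVK m.
  + by rewrite st' !alphabarVK st.
- move=> x; have -> : (1 = (iota 1)^-1 * iota 1)%g by rewrite mulVg.
  by rewrite alphabarG_frac alphabarK.
- move=> g h x; have [s [t ->]] := env_frac hG g.
  have [p [q ->]] := env_frac hG h.
  have [t' [p' e]] := hO p t.
  have -> : ((iota s)^-1 * iota t * ((iota p)^-1 * iota q) =
    (iota (t' * s))^-1 * iota (p' * q))%g.
    have e2 : (iota t * (iota p)^-1 = (iota t')^-1 * iota p')%g.
      apply: (mulgI (iota t')); rewrite mulVKg mulgA -(env_mul hG) e.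
      by rewrite (env_mul hG) mulgK.
    by rewrite !(env_mul hG) invgM !mulgA -[((iota s)^-1 * _ / _)%g]mulgA e2 !mulgA.
  rewrite !alphabarG_frac; apply: (can_inj (alphabarK s)); rewrite alphabarVK.
  apply: (can_inj (alphabarK t')); rewrite -!alphabar_mul alphabarVK e.
  by rewrite !alphabar_mul alphabarVK.
Qed.

End SstarAS.

Arguments alphabarG {K S A B alpha iA iS} hO hun hB {G iota} hG g x.

(* Main.v *)
Require Import Defs.
From HB Require Import structures.
From mathcomp Require Import all_boot all_order all_algebra.
From mathcomp Require Import sesquilinear.
From mathcomp Require Import all_classical all_reals all_analysis.
From mathcomp Require Import complex ring lra.

(* Both algebras are determined by their Hilbert space representations, by the
   Gelfand-Naimark theorem: for every nonzero [c] there are a representation and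
   a unit vector [xi] with [|pi(c) xi| = |c|]. By covariance [B] is generated by
   [iA(A)] and [iS(S)], and [C] by the corresponding elements [iD(iA(a))] and
   [u(iota(s))], because [S*AS] is the closure of the elements [s* a s]. A
   representation of [C] restricts to a covariant representation of [(A, S)].
   Conversely, since the [alpha_s] are unital, the [iS(s)] are unitary, so
   [s^-1 t |-> iS(s)* iS(t)] extends [iS] to [G], and a representation of [B]
   restricts to a covariant representation of [(S*AS, G)]. By the two universal
   properties the representations of [B] and of [C] correspond to each other, so
   matching generators defines an isometry of dense *-subalgebras.
   The norming representations come from the GNS construction. States norming
   [c* c] come from the Hahn-Banach theorem, applied to the norm and the vector
   [1 + c* c] of norm [1 + |c|^2]; that they are positive, and the value of this
   norm, rest on the positivity of [c* c] (Fukamiya, Kelley-Vaught, Kaplansky). *)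

Set Implicit Arguments.
Unset Strict Implicit.
Unset Printing Implicit Defensive.

Import Order.TTheory GRing.Theory Num.Theory.
Import numFieldNormedType.Exports.

Local Open Scope classical_set_scope.
Local Open Scope ring_scope.
Local Open Scope complex_scope.

(** * Identities in noncommutative rings *)

Module NCRing.

Inductive expr :=
  Var of nat | Zero | One | Add of expr & expr | Opp of expr | Mul of expr & expr.

Section Eval.
Variables (A : pzRingType) (env : seq A).

Fixpoint eval e : A :=
  match e with
  | Var n => env`_n | Zero => 0 | One => 1
  | Add a b => eval a + eval b | Opp a => - eval a | Mul a b => eval a * eval b
  end.

Definition word (w : seq nat) : A := \prod_(i <- w) env`_i.
Definition term (m : bool * seq nat) : A :=
  if m.1 then - word m.2 else word m.2.

Definition opp_term (m : bool * seq nat) := (~~ m.1, m.2).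
Definition mul_term (m n : bool * seq nat) := (m.1 (+) n.1, m.2 ++ n.2).

Fixpoint expand e : seq (bool * seq nat) :=
  match e with
  | Var n => [:: (false, [:: n])] | Zero => [::] | One => [:: (false, [::])]
  | Add a b => expand a ++ expand b | Opp a => map opp_term (expand a)
  | Mul a b => [seq mul_term m n | m <- expand a, n <- expand b]
  end.

Lemma expandE e : eval e = \sum_(m <- expand e) term m.
Proof.
elim: e => /= [n|||a -> b ->|a ->|a -> b ->].
- by rewrite big_seq1 /term /word /= big_seq1.
- by rewrite big_nil.
- by rewrite big_seq1 /term /word /= big_nil.
- by rewrite big_cat.
- rewrite big_map -sumrN; apply: eq_bigr => -[[] w] _ //; exact: opprK.
- rewrite big_allpairs_dep mulr_suml; apply: eq_bigr => -[s v] _.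
  rewrite mulr_sumr; apply: eq_bigr => -[t w] _.
  rewrite /term /word /mul_term /= big_cat.
  by case: s t => -[] /=; rewrite ?mulrNN ?mulrN ?mulNr.
Qed.

(** The difference of the two sides is expanded into signed words, a coefficient being recorded by
    repetition. It vanishes when the words with sign [-] are a permutation of those with sign
    [+]. *)
Definition check e1 e2 :=
  let l := expand (Add e1 (Opp e2)) in
  perm_eq [seq m.2 | m <- l & m.1] [seq m.2 | m <- l & ~~ m.1].

Lemma checkP e1 e2 : check e1 e2 -> eval e1 = eval e2.
Proof.
rewrite /check; set l := expand _ => pl; apply/eqP; rewrite -subr_eq0.
rewrite -[_ - _]/(eval (Add e1 (Opp e2))) expandE -/l.
rewrite (bigID (fun m : bool * seq nat => m.1)) /= -!(big_filter l).
rewrite (eq_big_seq (fun m => - word m.2)); last first.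
  by move=> [[] w]; rewrite mem_filter.
rewrite [X in _ + X](eq_big_seq (fun m => word m.2)); last first.
  by move=> [[] w]; rewrite mem_filter.
rewrite -(big_map (fun m => m.2) xpredT (fun w => - word w)) sumrN (perm_big _ pl).
by rewrite -(big_map (fun m => m.2) xpredT word) addNr.
Qed.

End Eval.

Ltac index x env :=
  lazymatch env with
  | x :: _ => constr:(0%N)
  | _ :: ?s => let n := index x s in constr:(S n)
  end.

Ltac add x env :=
  let rec mem s :=
    lazymatch s with
    | x :: _ => env
    | _ :: ?s' => mem s'
    | _ => constr:(x :: env)
    end in mem env.

Ltac atoms t env :=
  lazymatch t with
  | ?a + ?b => let e := atoms a env in atoms b e
  | ?a * ?b => let e := atoms a env in atoms b e
  | - ?a => atoms a env
  | 0 => env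
  | 1 => env
  | ?x => add x env
  end.

Ltac reify t env :=
  lazymatch t with
  | ?a + ?b => let x := reify a env in let y := reify b env in constr:(Add x y)
  | ?a * ?b => let x := reify a env in let y := reify b env in constr:(Mul x y)
  | - ?a => let x := reify a env in constr:(Opp x)
  | 0 => constr:(Zero)
  | 1 => constr:(One)
  | ?x => let n := index x env in constr:(Var n)
  end.

End NCRing.

Ltac ncring :=
  lazymatch goal with
  | |- @eq ?T ?a ?b =>
    let e := NCRing.atoms a (@nil T) in
    let e := NCRing.atoms b e in
    let x := NCRing.reify a e in
    let y := NCRing.reify b e in
    exact (@NCRing.checkP _ e x y isT)
  end.

(** * Real-valued norms *)

(** Norms of spaces over [R[i]] take values in [R[i]]; passing to [R] gives a total order, in which
    real arithmetic applies. *)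
Definition nrm (R : realType) (V : normedZmodType R[i]) (x : V) : R := complex.Re `|x|.

Section RealComplex.
Variable R : realType.
Implicit Types a b : R.

Lemma real_complexM a b : (a * b)%:C = a%:C * b%:C.
Proof. exact: rmorphM. Qed.

Lemma gt0_real_complex (e : R[i]) : 0 < e -> exists2 r : R, e = r%:C & 0 < r.
Proof.
rewrite ltcE/= => /andP[/eqP ie re]; exists (complex.Re e) => //.
by rewrite [LHS]complexE ie mulr0 addr0.
Qed.

End RealComplex.

Section RealNorm.
Variables (R : realType) (V : normedZmodType R[i]).
Implicit Types x y : V.

Lemma nrmE x : `|x| = (nrm x)%:C.
Proof. by rewrite RRe_real// normr_real. Qed.

Lemma nrm_ge0 x : 0 <= nrm x.
Proof. by rewrite -ler0c -nrmE. Qed.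

Lemma nrm_le x (r : R) : (nrm x <= r) = (`|x| <= r%:C).
Proof. by rewrite nrmE lecR. Qed.

Lemma nrmD x y : nrm (x + y) <= nrm x + nrm y.
Proof. by rewrite nrm_le rmorphD/= -!nrmE ler_normD. Qed.

Lemma nrmN x : nrm (- x) = nrm x.
Proof. by rewrite /nrm normrN. Qed.

Lemma nrmB x y : nrm (x - y) <= nrm x + nrm y.
Proof. by rewrite -(nrmN y) nrmD. Qed.

Lemma nrm_distC x y : nrm (x - y) = nrm (y - x).
Proof. by rewrite -nrmN opprB. Qed.

Lemma nrm_distD z x y : nrm (x - y) <= nrm (x - z) + nrm (z - y).
Proof. by have := nrmD (x - z) (z - y); rewrite subrKA. Qed.

Lemma nrm_distn x y : `|nrm x - nrm y| <= nrm (x - y).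
Proof.
have h (u v : V) : nrm u - nrm v <= nrm (u - v).
  by rewrite lerBlDr; have := nrmD (u - v) v; rewrite subrK.
by rewrite ler_norml h lerNl opprB nrm_distC h.
Qed.

Lemma nrm0 : nrm (0 : V) = 0.
Proof. by rewrite /nrm normr0. Qed.

Lemma nrm0_eq0 x : nrm x = 0 -> x = 0.
Proof. by move=> x0; apply: normr0_eq0; rewrite nrmE x0. Qed.

Lemma nrm_small x : (forall e : R, 0 < e -> nrm x <= e) -> x = 0.
Proof.
move=> xe; apply: nrm0_eq0; apply/eqP; rewrite eq_le nrm_ge0 andbT.
by apply/ler_addgt0Pl => e e0; rewrite addr0 xe.
Qed.

End RealNorm.

Section NormedModule.
Variables (R : realType) (V : normedModType R[i]).
Implicit Types x y : V.

Lemma nrmZ (k : R[i]) x : nrm (k *: x) = nrm k * nrm x.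
Proof. by apply: complexI; rewrite rmorphM/= -!nrmE normrZ. Qed.

Lemma nrmZr (r : R) x : nrm (r%:C *: x) = `|r| * nrm x.
Proof.
rewrite nrmZ; congr (_ * _); rewrite /nrm normc_def/= expr0n addr0.
by rewrite sqrtr_sqr.
Qed.

End NormedModule.

Section Complete.
Variables (R : realType) (V : completeNormedModType R[i]).

Lemma nrm_complete (u : nat -> V) :
  (forall e : R, 0 < e -> exists N, forall m n, (N <= m)%N -> (N <= n)%N ->
     nrm (u m - u n) <= e) ->
  exists l, forall e : R, 0 < e -> exists N, forall n, (N <= n)%N ->
     nrm (l - u n) <= e.
Proof.
move=> cu.
have : cvg (u @ \oo).
  apply: cauchy_cvg; apply: cauchy_exP => e e0.
  have [r -> r0] := gt0_real_complex e0.
  have [N HN] := cu (r / 2) ltac:(lra).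
  exists (u N), N => // n /= Nn; rewrite -ball_normE /= nrmE ltcR.
  by apply: le_lt_trans (HN _ _ _ _) _ => //; lra.
move=> /cvg_ex[l] /cvgrPdist_le ul; exists l => e e0.
have [|N _ HN] := ul e%:C; first by rewrite ltcR.
by exists N => n Nn; rewrite nrm_le; apply: HN.
Qed.

End Complete.

Section CStarNorm.
Variables (R : realType) (A : cstarType R[i]).
Implicit Types x y : A.

Lemma nrmM x y : nrm (x * y) <= nrm x * nrm y.
Proof. by rewrite nrm_le rmorphM/= -!nrmE cs_normM. Qed.

Lemma nrm_star x : nrm (star x) = nrm x.
Proof. by rewrite /nrm cs_norm_star. Qed.

Lemma nrm_id x : nrm (star x * x) = nrm x ^+ 2.
Proof. by apply: complexI; rewrite rmorphXn/= -!nrmE cs_identity. Qed.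

Lemma nrm_sa x : star x = x -> nrm (x * x) = nrm x ^+ 2.
Proof. by move=> sx; rewrite -{1}sx nrm_id. Qed.

(** Since [1] is a self-adjoint idempotent, its norm is [0] or [1]; the value [0] belongs to the
    zero algebra. *)
Lemma nrm1_le : nrm (1 : A) <= 1.
Proof.
have := nrm_sa (@cs_star1 _ A); rewrite mulr1 expr2 => /eqP.
rewrite -subr_eq0 -[X in X - _]mulr1 -mulrBr mulf_eq0 => /orP[/eqP->//|].
by rewrite subr_eq0 => /eqP <-.
Qed.

Lemma csB x y : star (x - y) = star x - star y.
Proof. by rewrite csD cs_starN. Qed.

Lemma cs_star0 : star (0 : A) = 0.
Proof. by have := csB 0 0; rewrite !subrr. Qed.

Lemma csZr (r : R) x : star (r%:C *: x) = r%:C *: star x.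
Proof. by rewrite csZ -[Num.conj _]/(conjc _) conjc_real. Qed.

End CStarNorm.

(** * Square root of [1 - z] for self-adjoint [z] in the unit ball *)

Section Sqrt.
Variables (R : realType) (A : cstarType R[i]) (z : A).
Hypotheses (sz : star z = z) (z1 : nrm z <= 1).

(* The fixed point [t] of the iteration satisfies [(1 - t)^2 = 1 - z]. *)
Fixpoint sqrt_it (n : nat) : A :=
  if n is m.+1 then (2^-1 : R)%:C *: (z + sqrt_it m * sqrt_it m) else 0.

(* The same iteration for the scalar [z = 1]; its increments dominate those of
   [sqrt_it], which gives convergence also when [nrm z = 1]. *)
Fixpoint sqrt_maj (n : nat) : R :=
  if n is m.+1 then 2^-1 * (1 + sqrt_maj m ^+ 2) else 0.

Lemma sqrt_maj_bound n : 0 <= sqrt_maj n <= 1.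
Proof.
elim: n => [|n /andP[r0 r1]]; first by rewrite /= lexx ler01.
by apply/andP; split => /=; nra.
Qed.

Lemma sqrt_maj_step n : sqrt_maj n <= sqrt_maj n.+1.
(* The increment is [(sqrt_maj n - 1) ^+ 2 / 2]. *)
Proof. by have := sqr_ge0 (sqrt_maj n - 1) => /=; nra. Qed.

Lemma sqrt_it_bound n : nrm (sqrt_it n) <= sqrt_maj n.
Proof.
elim: n => [|n IH]; first by rewrite nrm0.
rewrite nrmZr ger0_norm ?invr_ge0// ler_wpM2l ?invr_ge0//.
apply: le_trans (nrmD _ _) _; apply: lerD => //.
by apply: le_trans (nrmM _ _) _; rewrite expr2 ler_pM ?nrm_ge0.
Qed.

(** By [x * x - y * y = x * (x - y) + (x - y) * y], each increment is controlled by the previous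
    one; the increments of [sqrt_maj] obey the same recursion. *)
Lemma sqrt_it_step n :
  nrm (sqrt_it n.+1 - sqrt_it n) <= sqrt_maj n.+1 - sqrt_maj n.
Proof.
elim: n => [|n IH].
  rewrite /= mulr0 !addr0 !subr0 expr0n /= addr0 nrmZr.
  by rewrite ger0_norm ?invr_ge0// ler_wpM2l ?invr_ge0.
set x := sqrt_it n.+1 in IH *; set y := sqrt_it n in IH *.
set r := sqrt_maj n.+1 in IH *; set s := sqrt_maj n in IH *.
have -> : sqrt_it n.+2 - x = (2^-1 : R)%:C *: (x * (x - y) + (x - y) * y).
  by rewrite mulrBr mulrBl subrKA /x /= -/y -/x -scalerBr opprD addrACA subrr add0r.
have -> : sqrt_maj n.+2 - r = 2^-1 * (r * (r - s) + (r - s) * s).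
  by rewrite /r /= -/s -/r; field.
rewrite nrmZr ger0_norm ?invr_ge0// ler_wpM2l ?invr_ge0//.
apply: le_trans (nrmD _ _) _.
apply: lerD; apply: le_trans (nrmM _ _) _; apply: ler_pM; rewrite ?nrm_ge0//;
  exact: sqrt_it_bound.
Qed.

Lemma sqrt_it_dist m n : (n <= m)%N ->
  nrm (sqrt_it m - sqrt_it n) <= sqrt_maj m - sqrt_maj n.
Proof.
elim: m => [|m IH]; first by rewrite leqn0 => /eqP->; rewrite !subrr nrm0.
rewrite leq_eqVlt => /predU1P[->|]; first by rewrite !subrr nrm0.
rewrite ltnS => /IH h; apply: le_trans (nrm_distD (sqrt_it m) _ _) _.
by have := sqrt_it_step m; lra.
Qed.

(** The iteration is Cauchy because its increments are dominated by those of a bounded monotone real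
    sequence. *)
Lemma sqrt_it_cvg : exists l : A, forall e : R, 0 < e ->
  exists N, forall n, (N <= n)%N -> nrm (l - sqrt_it n) <= e.
Proof.
apply: nrm_complete => e e0.
have nd : nondecreasing_seq sqrt_maj by apply/nondecreasing_seqP; exact: sqrt_maj_step.
have cm : cvgn sqrt_maj.
  apply: nondecreasing_is_cvgn => //; exists 1 => _ [n _ <-].
  by case/andP: (sqrt_maj_bound n).
have le_lim n : sqrt_maj n <= limn sqrt_maj by exact: nondecreasing_cvgn_le.
have /cvgrPdist_le/(_ e e0)[N _ HN] := cm.
exists N => m n; wlog nm : m n / (n <= m)%N => [H Nm Nn|Nm Nn].
  have [nm|/ltnW mn] := leqP n m; first exact: H.
  by rewrite nrm_distC; exact: H.
apply: le_trans (sqrt_it_dist nm) _.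
by have := HN n Nn; rewrite /= ler_norml => /andP[_]; have := le_lim m; lra.
Qed.

Lemma sqrt_it_sa n : star (sqrt_it n) = sqrt_it n.
Proof.
elim: n => [|n IH]; first by rewrite /= cs_star0.
by rewrite /= csZr csD csM IH sz.
Qed.

Lemma sqrt_it_comm w n : w * z = z * w -> w * sqrt_it n = sqrt_it n * w.
Proof.
move=> wz; elim: n => [|n IH]; first by rewrite /= mulr0 mul0r.
by rewrite /= csMZl csMZr mulrDl mulrDr wz -mulrA -IH !mulrA IH.
Qed.

(** With [l] the limit of the iteration, the root is [1 - l]. The bound [nrm (1 - y) <= 1] will make
    it positive, and commutation passes to the limit from the iterates, which are polynomials in
    [z]. *)
Lemma sqrt_ex : exists y : A, [/\ star y = y, y * y = 1 - z, nrm (1 - y) <= 1 &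
  forall w, w * z = z * w -> w * y = y * w].
Proof.
have [l Hl] := sqrt_it_cvg.
have bnd n : nrm (sqrt_it n) <= 1.
  by apply: le_trans (sqrt_it_bound n) _; case/andP: (sqrt_maj_bound n).
have l1 : nrm l <= 1.
  apply/ler_addgt0Pl => e e0; have [N /(_ N (leqnn N)) HN] := Hl e e0.
  rewrite -(subrK (sqrt_it N) l).
  exact: le_trans (nrmD _ _) (lerD HN (bnd N)).
have sl : star l = l.
  apply/eqP; rewrite -subr_eq0; apply/eqP/nrm_small => e e0.
  have [N /(_ N (leqnn N)) HN] := Hl (e / 2) ltac:(lra).
  have -> : star l - l = star (l - sqrt_it N) - (l - sqrt_it N).
    by rewrite csB sqrt_it_sa; ncring.
  by apply: le_trans (nrmB _ _) _; rewrite nrm_star; lra.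
have cl w : w * z = z * w -> w * l = l * w.
  move=> wz; apply/eqP; rewrite -subr_eq0; apply/eqP/nrm_small => e e0.
  have w0 := nrm_ge0 w.
  have d0 : 0 < e / (2 * (nrm w + 1)) by rewrite divr_gt0//; lra.
  have [N /(_ N (leqnn N)) HN] := Hl _ d0.
  have -> : w * l - l * w = w * (l - sqrt_it N) - (l - sqrt_it N) * w.
    by rewrite mulrBr mulrBl sqrt_it_comm// opprB addrA subrK.
  apply: le_trans (nrmB _ _) _.
  have h : nrm w * nrm (l - sqrt_it N) <= e / 2.
    apply: le_trans (_ : (nrm w + 1) * (e / (2 * (nrm w + 1))) <= _).
      by apply: ler_pM; rewrite ?nrm_ge0//; lra.
    by rewrite le_eqVlt; apply/orP; left; apply/eqP; field; lra.
  have := nrmM w (l - sqrt_it N); have := nrmM (l - sqrt_it N) w.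
  by rewrite [X in _ <= X -> _]mulrC; lra.
have fl : z + l * l = l + l.
  apply/eqP; rewrite -subr_eq0; apply/eqP/nrm_small => e e0.
  have [N HN] := Hl (e / 4) ltac:(lra).
  have := HN N (leqnn N); have := HN N.+1 (leqnSn N).
  set x := sqrt_it N.+1; set y := sqrt_it N => h1 h2.
  have ex : x + x = z + y * y.
    rewrite /x /= -/y -scalerDl -rmorphD/= (_ : _ + _ = 1) ?scale1r//.
    by field.
  (* Eliminating [z] through [x + x = z + y * y] leaves only the distances from [l] to the
     consecutive iterates [x] and [y]. *)
  have -> : z + l * l - (l + l) =
      (l * (l - y) + (l - y) * y) - ((l - x) + (l - x)).
    by have -> : z = x + x - y * y; [rewrite ex addrK|ncring].
  apply: le_trans (nrmB _ _) _.
  have b1 := nrmD (l * (l - y)) ((l - y) * y).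
  have b2 := nrmD (l - x) (l - x).
  have b3 : nrm (l * (l - y)) <= nrm (l - y).
    by apply: le_trans (nrmM _ _) _; rewrite ler_piMl ?nrm_ge0.
  have b4 : nrm ((l - y) * y) <= nrm (l - y).
    by apply: le_trans (nrmM _ _) _; rewrite ler_piMr ?nrm_ge0// bnd.
  lra.
exists (1 - l); split.
- by rewrite csB cs_star1 sl.
- by have -> : z = l + l - l * l; [rewrite -fl addrK|ncring].
- by rewrite opprB addrC subrK.
- by move=> w /cl wl; rewrite mulrBr mulrBl mulr1 mul1r wl.
Qed.

End Sqrt.

(** * Positive elements *)

Section Positive.
Variables (R : realType) (A : cstarType R[i]).
Implicit Types h p u v w x y : A.

(** For self-adjoint [h] and [t >= nrm h] this is equivalent to [nrm (scal t - h) <= t], by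
    [pos_dist] and [dist_pos]. *)
Definition pos h := exists2 w, star w = w & h = w * w.

Definition scal (t : R) : A := t%:C *: (1 : A).

Lemma scal_mull t x : scal t * x = t%:C *: x.
Proof. by rewrite csMZl mul1r. Qed.

Lemma scal_mulr t x : x * scal t = t%:C *: x.
Proof. by rewrite csMZr mulr1. Qed.

Lemma half_double x : (2^-1 : R)%:C *: (x + x) = x.
Proof.
rewrite scalerDr -scalerDl -rmorphD/= (_ : _ + _ = 1) ?scale1r//.
by field.
Qed.

Lemma nrm_scal_le t : 0 <= t -> nrm (scal t) <= t.
Proof. by move=> t0; rewrite nrmZr ger0_norm// ler_piMr// nrm1_le. Qed.

Lemma scal_sa t : star (scal t) = scal t.
Proof. by rewrite csZr cs_star1. Qed.

Lemma csZi x : star ('i *: x) = - ('i *: star x).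
Proof.
rewrite csZ -scaleNr; congr (_ *: _).
by apply/eqP; rewrite eq_complex /= !oppr0 !eqxx.
Qed.

Lemma pos_sa h : pos h -> star h = h.
Proof. by case=> w sw ->; rewrite csM sw. Qed.

Lemma pos_scale (r : R) h : 0 <= r -> pos h -> pos (r%:C *: h).
Proof.
move=> r0 [w sw ->]; exists ((Num.sqrt r)%:C *: w); first by rewrite csZr sw.
by rewrite csMZl csMZr scalerA -rmorphM/= -[Num.sqrt r * _]expr2 sqr_sqrtr.
Qed.

(* For [x = u + i v] one has [star x * x = u^2 + v^2] and [u] is the real part
   of [x]. *)
Lemma nrm_sqr_le u v : star u = u -> star v = v -> u * v = v * u ->
  nrm u ^+ 2 <= nrm (u * u + v * v).
Proof.
move=> su sv uv; set iv := 'i *: v.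
have siv : star iv = - iv by rewrite csZi sv.
have iviv : iv * iv = - (v * v).
  rewrite csMZl csMZr scalerA (_ : _ * _ = -1) ?scaleN1r//.
  by rewrite -expr2 sqr_i.
have uiv : u * iv = iv * u by rewrite csMZl csMZr uv.
have sx : star (u + iv) = u - iv by rewrite csD su siv.
have -> : u * u + v * v = star (u + iv) * (u + iv).
  rewrite sx; have -> : v * v = - (iv * iv) by rewrite iviv opprK.
  have -> : (u - iv) * (u + iv) = u * u - iv * iv + (u * iv - iv * u) by ncring.
  by rewrite uiv subrr addr0.
rewrite nrm_id ler_pXn2r// ?nnegrE ?nrm_ge0//.
have eu : u = (2^-1 : R)%:C *: (u + iv + star (u + iv)).
  by rewrite sx addrACA subrr addr0 half_double.
rewrite {1}eu nrmZr ger0_norm ?invr_ge0//.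
by have := nrmD (u + iv) (star (u + iv)); rewrite nrm_star; lra.
Qed.

(** The root [y] of [1 - w * w] commutes with [w], and [y * y + w * w = 1], so [nrm_sqr_le] bounds
    [nrm y ^+ 2 = nrm (1 - w * w)] by [nrm 1]. *)
Lemma nrm_1B_sqr w : star w = w -> nrm w <= 1 -> nrm (1 - w * w) <= 1.
Proof.
move=> sw w1.
have [||y [sy yy _ cy]] := @sqrt_ex _ _ (w * w).
- by rewrite csM sw.
- by rewrite nrm_sa// expr_le1 ?nrm_ge0.
rewrite -yy nrm_sa//; apply: le_trans (nrm_sqr_le sy sw _) _.
  by rewrite cy// mulrA.
by rewrite yy subrK nrm1_le.
Qed.

Lemma pos_dist h (t : R) : pos h -> nrm h <= t -> nrm (scal t - h) <= t.
Proof.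
move=> [w sw ->] wt; have := wt; rewrite nrm_sa// => wt2.
have [t0|t0] := ltP 0 t; last first.
  have t_0 : t = 0 by apply/eqP; rewrite eq_le t0; apply: le_trans wt; exact: nrm_ge0.
  by move: wt; rewrite t_0 /scal scale0r sub0r nrmN.
set s := Num.sqrt t; have s0 : 0 < s by rewrite sqrtr_gt0.
have sp := ltW s0; have tp := ltW t0.
have ss : s * s = t by rewrite -expr2 sqr_sqrtr// ltW.
set v : A := s^-1%:C *: w.
have ew : w * w = t%:C *: (v * v).
  rewrite /v csMZl csMZr !scalerA -!rmorphM/= -ss.
  by rewrite (_ : s * s * (s^-1 / s) = 1) ?scale1r//; field; rewrite gt_eqF.
have v1 : nrm v <= 1.
  rewrite nrmZr ger0_norm ?invr_ge0// ler_pdivrMl// mulr1.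
  by rewrite -(ler_pXn2r (n:=2))// ?nnegrE ?nrm_ge0// expr2 [X in _ <= X]expr2 ss -expr2.
rewrite ew -scalerBr nrmZr ger0_norm// ler_piMr// nrm_1B_sqr//.
by rewrite csZr sw.
Qed.

(** For [t > 0], [h / t = 1 - z] with [nrm z <= 1], and [sqrt_ex] applies. The norm bound on [w] has
    the same form as that on [h] and shows that the root is itself positive. *)
Lemma dist_sqrt h (t : R) : star h = h -> nrm (scal t - h) <= t ->
  exists w, [/\ star w = w, w * w = h, nrm (scal (Num.sqrt t) - w) <= Num.sqrt t &
    forall v, v * h = h * v -> v * w = w * v].
Proof.
move=> sh ht; have [t0|t0] := ltP 0 t; last first.
  have t_0 : t = 0 by apply/eqP; rewrite eq_le t0; apply: le_trans ht; exact: nrm_ge0.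
  exists h; have h0 : h = 0.
    apply: nrm0_eq0; apply/eqP; rewrite eq_le nrm_ge0 andbT -nrmN.
    by move: ht; rewrite t_0 /scal scale0r sub0r.
  by rewrite t_0 sqrtr0 /scal scale0r h0 cs_star0 mulr0 subrr nrm0; split.
set s := Num.sqrt t; have s0 : 0 < s by rewrite sqrtr_gt0.
have sp := ltW s0; have tp := ltW t0.
have ss : s * s = t by rewrite -expr2 sqr_sqrtr// ltW.
have tn : t != 0 by rewrite gt_eqF.
pose z : A := 1 - t^-1%:C *: h.
have [||y [sy yy y1 cy]] := @sqrt_ex _ _ z.
- by rewrite csB csZr cs_star1 sh.
- have -> : z = t^-1%:C *: (scal t - h).
    by rewrite scalerBr scalerA -rmorphM/= mulVf// scale1r.
  by rewrite nrmZr ger0_norm ?invr_ge0// ler_pdivrMl// mulr1.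
exists (s%:C *: y); split.
- by rewrite csZr sy.
- rewrite csMZl csMZr scalerA -rmorphM/= ss yy /z opprB addrC subrK.
  by rewrite scalerA -rmorphM/= mulfV// scale1r.
- by rewrite -scalerBr nrmZr ger0_norm// ler_piMr.
- move=> v vh; rewrite csMZl csMZr cy// /z mulrBl mulrBr mul1r mulr1.
  by rewrite csMZl csMZr vh.
Qed.

Lemma dist_pos h (t : R) : star h = h -> nrm (scal t - h) <= t -> pos h.
Proof. by move=> sh /(dist_sqrt sh)[w [sw wh _ _]]; exists w. Qed.

Lemma pos_sqrt h : pos h ->
  exists w, [/\ pos w, w * w = h & forall v, v * h = h * v -> v * w = w * v].
Proof.
move=> ph; have sh := pos_sa ph.
have [w [sw wh /(dist_pos sw) pw cw]] := dist_sqrt sh (pos_dist ph (lexx _)).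
by exists w.
Qed.

(** The inequalities [nrm (scal t - h) <= t] that characterize positivity add up. *)
Lemma pos_add h p : pos h -> pos p -> pos (h + p).
Proof.
move=> ph pp; apply: (@dist_pos _ (nrm h + nrm p)).
  by rewrite csD !pos_sa.
have -> : scal (nrm h + nrm p) - (h + p) = (scal (nrm h) - h) + (scal (nrm p) - p).
  by rewrite /scal rmorphD/= scalerDl addrACA opprD.
by apply: le_trans (nrmD _ _) _; apply: lerD; exact: pos_dist.
Qed.

(** With [t = nrm (h + p)], write [h = u * u] and [scal t - h = v * v] for commuting [u] and [v];
    then [nrm_sqr_le] gives [nrm h <= nrm (scal t) <= t]. *)
Lemma nrm_pos_le h p : pos h -> pos p -> nrm h <= nrm (h + p).
Proof.
move=> ph pp; set t := nrm (h + p).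
have /pos_sqrt[v [pv vv cv]] : pos (scal t - h).
  have -> : scal t - h = (scal t - (h + p)) + p by ncring.
  apply: pos_add => //; apply: (@dist_pos _ t).
    by rewrite csB scal_sa pos_sa//; exact: pos_add.
  by rewrite opprB addrC subrK.
have [u su hu] := ph; rewrite hu nrm_sa//.
apply: le_trans (nrm_sqr_le su (pos_sa pv) _) _.
  by rewrite cv// mulrBl mulrBr scal_mull scal_mulr hu mulrA.
by rewrite vv hu addrC subrK nrm_scal_le// nrm_ge0.
Qed.

(* With [p = q^2], [M = |y|^2] and [b = y * star y], which is a sum of squares
   because [star y * y + b] is one, [|M - b| <= M]. Hence
   [M^3 >= |star y * (M - b)^2 * y| = |M^2 p + 2 M p^2 + p^3| >= 2 M |p|^2]. *)
Lemma negative_square_eq0 y q : star q = q -> star y * y = - (q * q) -> y = 0.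
Proof.
move=> sq yq; set p := q * q; set M := nrm y ^+ 2.
have M0 : 0 <= M by rewrite exprn_ge0// nrm_ge0.
have pp : pos p by exists q.
have sp := pos_sa pp.
have pb : pos (y * star y).
  (* Here [2 y = a - i c], and [a * a + c * c = 2 (y * star y + star y * y)]. *)
  pose a := y + star y; pose c : A := 'i *: (y - star y).
  have sa : star a = a by rewrite csD csK addrC.
  have scc : star c = c.
    by rewrite csZi csB csK -scalerN opprB.
  have cc : c * c = - ((y - star y) * (y - star y)).
    by rewrite csMZl csMZr scalerA -expr2 sqr_i scaleN1r.
  have -> : y * star y = (2^-1 : R)%:C *: (a * a + c * c) + p.
    apply: (@addIr _ (star y * y)); rewrite -addrA yq subrr addr0 -yq cc.
    have -> : a * a - (y - star y) * (y - star y) =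
      (y * star y + star y * y) + (y * star y + star y * y) by rewrite /a; ncring.
    by rewrite half_double.
  apply: pos_add => //; apply: pos_scale; first by rewrite invr_ge0.
  by apply: pos_add; [exists a|exists c].
have nb : nrm (y * star y) = M by rewrite -{1}(csK y) nrm_id nrm_star.
have np : nrm p = M by rewrite /M -nrm_id yq nrmN.
have db : nrm (scal M - y * star y) <= M by apply: pos_dist; rewrite ?nb.
pose g := (scal M - y * star y) * y.
have eg : g = y * (scal M + p).
  rewrite /g mulrBl mulrDr scal_mull scal_mulr -mulrA yq mulrN opprK//.
have gg : star g * g = - ((2 * M)%:C *: (p * p) + ((M * M)%:C *: p + p * p * p)).
  have -> : star g * g = (scal M + p) * (star y * y) * (scal M + p).
    by rewrite eg csM csD sp scal_sa !mulrA.
  rewrite yq -/p mulrN mulNr; congr (- _).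
  have -> : (scal M + p) * p * (scal M + p) =
    scal M * p * scal M + (scal M * p * p + p * p * scal M) + p * p * p by ncring.
  rewrite !scal_mull !scal_mulr csMZl scalerA -rmorphM/= -scalerDl -rmorphD/=.
  rewrite (_ : 2 * M = M + M); last by ring.
  by rewrite [_ *: p + _]addrC !addrA.
have pq : pos (p * p * p) by exists (q * p); rewrite ?csM ?sp ?sq /p !mulrA.
have pos1 : pos ((M * M)%:C *: p + p * p * p).
  by apply: pos_add => //; apply: pos_scale => //; exact: mulr_ge0.
have pos2 : pos ((2 * M)%:C *: (p * p)).
  by apply: pos_scale; [rewrite mulr_ge0|exists p].
have := nrm_pos_le pos2 pos1; rewrite -[X in _ <= X]nrmN -gg nrm_id.
have M2 : 0 <= 2 * M by rewrite mulr_ge0.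
rewrite nrmZr (ger0_norm M2) (nrm_sa sp) np => h1.
have h2 : nrm g <= M * nrm y.
  by apply: le_trans (nrmM _ _) _; rewrite ler_wpM2r ?nrm_ge0.
have h3 : nrm g ^+ 2 <= (M * nrm y) ^+ 2.
  by rewrite ler_pXn2r// ?nnegrE ?mulr_ge0 ?nrm_ge0.
have M00 : M = 0.
  apply/eqP; apply: contraT => Mn; have Mp : 0 < M by rewrite lt_def Mn.
  have : 0 < M * M * M by apply: mulr_gt0 => //; exact: mulr_gt0.
  by move: h3; rewrite exprMn -/M; nra.
by apply: nrm0_eq0; move/eqP: M00; rewrite expf_eq0 /= => /eqP.
Qed.

Lemma sqr_eq0 x : star x = x -> x * x = 0 -> x = 0.
Proof.
move=> sx xx; apply: nrm0_eq0; have := nrm_sa sx; rewrite xx nrm0.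
by move/esym/eqP; rewrite expf_eq0 /= => /eqP.
Qed.

(* With [m] the positive square root of [h^2], [y = x (m - h)] satisfies
   [star y * y = (m - h) h (m - h) = - (m - h) m (m - h)], so [y = 0]. *)
Lemma pos_star_mul x : pos (star x * x).
Proof.
set h := star x * x.
have sh : star h = h by rewrite csM csK.
have [m [pm mm cm]] := @pos_sqrt (h * h) ltac:(by exists h).
have sm := pos_sa pm.
have hm : h * m = m * h by apply: cm; rewrite mulrA.
have [k [pk kk ck]] := pos_sqrt pm.
have sk := pos_sa pk.
have kh : k * h = h * k by rewrite -ck// hm.
have km : k * m = m * k by rewrite -kk mulrA.
pose d := m - h; pose q := k * d.
have sd : star d = d by rewrite csB sm sh.
have kd : k * d = d * k by rewrite mulrBr mulrBl kh km.
have sq : star q = q by rewrite csM sd sk -kd.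
have hd : h * d = - (m * d).
  by rewrite !mulrBr -mm hm opprB.
have xd : star (x * d) * (x * d) = - (q * q).
  rewrite csM sd -mulrA (mulrA (star x)) -/h hd mulrN; congr (- _).
  by rewrite -kk /q [X in _ = X * _]kd !mulrA.
have xd0 : x * d = 0 := negative_square_eq0 sq xd.
have q0 : q = 0.
  by apply: sqr_eq0 => //; rewrite -[LHS]opprK -xd xd0 mulr0 oppr0.
have d0 : d = 0.
  apply: sqr_eq0 => //.
  have md : m * d = 0 by rewrite -kk -mulrA -/q q0 mulr0.
  have -> : d * d = m * d - h * d by rewrite mulrBl.
  by rewrite hd md !oppr0 addr0.
by have /eqP := d0; rewrite subr_eq0 => /eqP <-.
Qed.

(** With [h = star x * x] and [s = nrm (1 + h)], the elements [h] and [s - (1 + h)] are positive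
    with sum [s - 1], so [nrm h <= s - 1] by [nrm_pos_le]. *)
Lemma nrm_1D_star_mul x : (1 : A) != 0 -> nrm (1 + star x * x) = 1 + nrm x ^+ 2.
Proof.
move=> A1; have n1 : nrm (1 : A) = 1.
  have nn : nrm (1 : A) ^+ 2 = nrm (1 : A).
    by rewrite -(nrm_sa (@cs_star1 _ A)) mulr1.
  have nz : nrm (1 : A) != 0 by apply: contra_neq A1; exact: nrm0_eq0.
  by apply: (mulIf nz); rewrite mul1r -expr2.
have ph := pos_star_mul x; set h := star x * x in ph *.
have p1 : pos (1 : A) by exists 1; rewrite ?cs_star1 ?mulr1.
have nh : nrm h = nrm x ^+ 2 by rewrite nrm_id.
apply/eqP; rewrite eq_le -{1}n1 -nh nrmD /=.
set s := nrm (1 + h).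
have s1 : 1 <= s by rewrite -n1; exact: nrm_pos_le.
have ps : pos (scal s - (1 + h)).
  apply: (@dist_pos _ s); last by rewrite opprB addrC subrK.
  by rewrite csB scal_sa csD cs_star1 pos_sa.
have := nrm_pos_le ph ps.
have -> : h + (scal s - (1 + h)) = scal (s - 1).
  have -> : h + (scal s - (1 + h)) = scal s - 1 by ncring.
  by rewrite /scal rmorphB rmorph1 scalerBl scale1r.
by move=> /le_trans/(_ (nrm_scal_le _)); rewrite subr_ge0 => /(_ s1); rewrite lerBrDl.
Qed.

End Positive.

(** * States *)

Section HahnBanach.
Variables (R : realType) (V : lmodType R[i]).
Implicit Types (p q m f : V -> R) (x y : V) (t : R).

Definition sublinear p :=
  (forall x y, p (x + y) <= p x + p y) /\
  (forall t x, 0 < t -> p (t%:C *: x) <= t * p x).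

Lemma sublinearZ p t x : sublinear p -> 0 <= t -> p (t%:C *: x) = t * p x.
Proof.
move=> [pD pZ]; rewrite le_eqVlt => /predU1P[<-|t0].
  rewrite scale0r mul0r; have h : p (0 + 0) <= p 0 + p 0 := pD 0 0.
  have h2 := pZ 2^-1 0 ltac:(by rewrite invr_gt0).
  move: h h2; rewrite addr0 scaler0 => h h2.
  by apply/eqP; rewrite eq_le; apply/andP; split; lra.
have tn : t != 0 by rewrite gt_eqF.
apply/eqP; rewrite eq_le pZ// andTb.
have := pZ t^-1 (t%:C *: x); rewrite invr_gt0 => /(_ t0).
rewrite scalerA -rmorphM/= mulVf// scale1r => h.
have := ler_wpM2l (ltW t0) h.
by rewrite mulrA mulfV// mul1r.
Qed.

Lemma sublinear0 p : sublinear p -> p 0 = 0.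
Proof. by move=> sp; rewrite -(scale0r 0) (sublinearZ _ sp) ?mul0r. Qed.

Lemma sublinear_opp p x : sublinear p -> - p (- x) <= p x.
Proof.
move=> sp; have [pD _] := sp; have := pD x (- x).
by rewrite subrr sublinear0//; lra.
Qed.

(** Serves both for [sublinear_shift] and for the lower bounds of chains in [hahn_banach]. *)
Lemma inf_sublinear (I : Type) (P : set I) (g : I -> V -> R) :
  P !=set0 ->
  (forall x, exists b, forall i, P i -> b <= g i x) ->
  (forall i j x y, P i -> P j -> exists2 k, P k & g k (x + y) <= g i x + g j y) ->
  (forall i t x, P i -> 0 < t -> exists2 k, P k & g k (t%:C *: x) <= t * g i x) ->
  exists q, [/\ sublinear q, forall i x, P i -> q x <= g i x &
    forall b x, (forall i, P i -> b <= g i x) -> b <= q x].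
Proof.
move=> [i0 Pi0] gb gD gZ; pose q x := inf [set g i x | i in P].
have ne x : [set g i x | i in P] !=set0 by exists (g i0 x); exists i0.
have q_le i x : P i -> q x <= g i x.
  move=> Pi; apply: ge_inf; last by exists i.
  by have [b Hb] := gb x; exists b => _ [j Pj <-]; exact: Hb.
have q_ge b x : (forall i, P i -> b <= g i x) -> b <= q x.
  by move=> Hb; apply: lb_le_inf => // _ [i Pi <-]; exact: Hb.
exists q; split => //; split.
- move=> x y; rewrite -lerBlDr; apply: (q_ge) => i Pi.
  rewrite lerBlDr -lerBlDl; apply: (q_ge) => j Pj.
  by rewrite lerBlDl; have [k Pk] := gD _ _ x y Pi Pj; apply: le_trans; exact: q_le.
- move=> t x t0; rewrite mulrC -ler_pdivrMr//; apply: (q_ge) => i Pi.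
  rewrite ler_pdivrMr// mulrC; have [k Pk] := gZ _ _ x Pi t0.
  by apply: le_trans; exact: q_le.
Qed.

(* [q x] is the infimum over [t >= 0] of [m (x + t y) - t m y]. *)
Lemma sublinear_shift m y : sublinear m ->
  exists q, [/\ sublinear q, forall x, q x <= m x &
    forall x, q x <= m (x + y) - m y].
Proof.
move=> sm; have [mD mZ] := sm.
have [||i j x1 x2|i t x|q [sq q_le _]] := @inf_sublinear R [set t | 0 <= t]
    (fun t x => m (x + t%:C *: y) - t * m y).
- by exists 0 => /=.
- move=> x; exists (- m (- x)) => t /= t0.
  have := mD (x + t%:C *: y) (- x).
  by rewrite addrAC subrr add0r sublinearZ//; lra.
- move=> /= i0 j0; exists (i + j); first exact: addr_ge0.
  rewrite rmorphD/= scalerDl addrACA.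
  by have := mD (x1 + i%:C *: y) (x2 + j%:C *: y); lra.
- move=> /= i0 t0; exists (t * i); first by rewrite mulr_ge0// ltW.
  rewrite rmorphM/= -scalerA -scalerDr.
  by have := mZ t (x + i%:C *: y) t0; lra.
exists q; split => // x.
- by have := q_le 0 x (lexx _); rewrite scale0r mul0r addr0 subr0.
- by have := q_le 1 x ler01; rewrite scale1r mul1r.
Qed.

(** A minimal sublinear functional [f] is additive: its shift in direction [y] lies below [f], hence
    equals [f], and the bound on the shift reads [f x <= f (x + y) - f y]. Minimality is taken below
    the shift [p0] of [p] in direction [x0]; since [p0 (- x0) <= - p x0], this forces
    [f x0 = p x0]. *)
Lemma hahn_banach p (x0 : V) : sublinear p ->
  exists f, [/\ forall x y, f (x + y) = f x + f y,
    forall t x, f (t%:C *: x) = t * f x, forall x, f x <= p x & f x0 = p x0].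
Proof.
move=> sp; have [p0 [sp0 p0p p0x]] := sublinear_shift x0 sp.
pose T := {q : V -> R | sublinear q /\ forall x, q x <= p0 x}.
(* The order is reversed, so that a maximal element for Zorn's lemma is a minimal functional. *)
pose rT (a b : T) := `[< forall x, sval b x <= sval a x >].
have [m mmin] : exists a : T, forall b : T, rT a b -> b = a.
  apply: Zorn.
  - by move=> q; apply/asboolP.
  - move=> a b d /asboolP ab /asboolP bd; apply/asboolP => x.
    exact: le_trans (bd x) (ab x).
  - move=> [a Ha] [b Hb] /asboolP /= ab /asboolP /= ba; apply: eq_exist.
    by apply/funext => x; apply/eqP; rewrite eq_le ba ab.
  - move=> P Ptot; have [[a0 Pa0]|Pe] := pselect (P !=set0); last first.
      (* The empty chain is bounded by [p0]. *)
      exists (exist _ p0 (conj sp0 (fun x => lexx _))) => s Ps.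
      by exfalso; apply: Pe; exists s.
    have [|||i t x Pi t0|q [sq q_le _]] := @inf_sublinear T P (fun a => sval a).
    + by exists a0.
    + move=> x; exists (- p0 (- x)) => -[a [sa ap]] _ /=.
      by apply: le_trans (sublinear_opp _ sa); rewrite lerN2.
    + move=> a b x y Pa Pb; have [/asboolP ab|/asboolP ba] := Ptot a b Pa Pb.
        exists b => //; case: b ab {Pb} => b [[bD _] _] /= ab.
        by apply: le_trans (bD _ _) _; rewrite lerD2r.
      exists a => //; case: a ba {Pa} => a [[aD _] _] /= ba.
      by apply: le_trans (aD _ _) _; rewrite lerD2l.
    + by exists i => //; case: i {Pi} => a [[_ aZ] _] /=; exact: aZ.
    have qp : forall x, q x <= p0 x.
      by move=> x; apply: le_trans (q_le _ x Pa0) _; case: a0 {Pa0} => a [].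
    exists (exist _ q (conj sq qp)) => s Ps; apply/asboolP => x /=.
    exact: q_le.
case: m mmin => f [sf fp0] /= fmin; have [fD fZ] := sf.
have fD' x y : f (x + y) = f x + f y.
  have [q [sq qf qs]] := sublinear_shift y sf.
  have qp : forall x, q x <= p0 x by move=> z; exact: le_trans (qf z) (fp0 z).
  have := fmin (exist _ q (conj sq qp)); rewrite /rT /= => /(_ (asboolT qf)) [qE].
  by apply/eqP; rewrite eq_le fD /=; have := qs x; rewrite qE; lra.
have f0 := sublinear0 sf.
have fN x : f (- x) = - f x by have := fD' x (- x); rewrite subrr f0; lra.
have fx0 : f x0 = p x0.
  apply/eqP; rewrite eq_le; apply/andP; split.
    exact: le_trans (fp0 _) (p0p _).
  have := le_trans (fp0 (- x0)) (p0x _).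
  by rewrite addNr (sublinear0 sp) fN; lra.
exists f; split => // [t x|x]; last exact: le_trans (fp0 x) (p0p x).
have [t0|t0] := leP 0 t; first exact: sublinearZ.
by rewrite -[t]opprK rmorphN/= scaleNr fN sublinearZ// ?mulNr// oppr_ge0 ltW.
Qed.

End HahnBanach.

(** * States norming [star c * c] *)

Section States.
Variables (R : realType) (A : cstarType R[i]).

Record positive_functional (phi : A -> R[i]) : Prop := {
  pf_linear : forall k x y, phi (k *: x + y) = k * phi x + phi y;
  pf_star : forall x, phi (star x) = conjc (phi x);
  pf_ge0 : forall x, 0 <= phi (star x * x)
}.

(** The functional [f] attains [nrm (1 + star c * c) = 1 + nrm c ^+ 2], while [f 1 <= 1] and
    [f (star c * c) <= nrm c ^+ 2]; both must be equalities. *)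
Lemma norming_state (c : A) : c != 0 ->
  exists phi, [/\ positive_functional phi, phi 1 = 1 &
    phi (star c * c) = (nrm c ^+ 2)%:C].
Proof.
move=> c0; have A1 : (1 : A) != 0.
  by apply: contra_neq c0 => A0; rewrite -[c]mul1r A0 mul0r.
have sn : sublinear (fun x : A => nrm x).
  split=> [x y|t x t0]; first exact: nrmD.
  by rewrite nrmZr ger0_norm// ltW.
have [f [fD fZ fn]] := hahn_banach (1 + star c * c) sn.
rewrite nrm_1D_star_mul// fD => fx.
have f1 : f 1 = 1.
  have := fn 1; have := fn (star c * c); have := nrm1_le A; rewrite nrm_id; lra.
have fc : f (star c * c) = nrm c ^+ 2 by lra.
have f0 : f 0 = 0 by have := fZ 0 0; rewrite scaler0 mul0r.
have fN x : f (- x) = - f x by have := fD x (- x); rewrite subrr f0; lra.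
(* Averaging over the involution makes the functional hermitian and keeps its values on self-adjoint
   elements. *)
pose F x := 2^-1 * f (x + star x).
have Fsa x : star x = x -> F x = f x.
  by move=> sx; rewrite /F sx fD; field.
have FD x y : F (x + y) = F x + F y.
  by rewrite /F csD addrACA fD mulrDr.
have FZ t x : F (t%:C *: x) = t * F x.
  by rewrite /F csZr -scalerDr fZ mulrCA.
have Fs x : F (star x) = F x by rewrite /F csK addrC.
have FN x : F (- x) = - F x by rewrite -scaleN1r -(rmorphN1 (real_complex R)) FZ mulN1r.
(* The complex linear functional with real part [F]. *)
pose phi x : R[i] := F x -i* F ('i *: x).
have Fi x : F ('i *: star x) = - F ('i *: x).
  by rewrite -(Fs ('i *: x)) csZi FN opprK.
have phisa x : star x = x -> phi x = (f x)%:C.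
  move=> sx; rewrite /phi Fsa//; congr (_ +i* _).
  by have := Fi x; rewrite sx; lra.
exists phi; split; last 2 first.
- by rewrite phisa ?f1// cs_star1.
- by rewrite phisa ?fc// csM csK.
split.
- move=> k x y; rewrite /phi; case: k => a b.
  have FZc z : F ((a +i* b) *: z) = a * F z + b * F ('i *: z).
    have -> : a +i* b = a%:C + b%:C * 'i by rewrite [LHS]complexE mulrC.
    by rewrite scalerDl -scalerA FD !FZ.
  rewrite !scalerDr !FD scalerA [_ * (_ +i* _)]mulrC -scalerA !FZc scalerA -expr2 sqr_i.
  by rewrite scaleN1r FN; apply/eqP; rewrite eq_complex /=; apply/andP; split; apply/eqP; ring.
- by move=> x; rewrite /phi Fs Fi.
- move=> x; rewrite phisa; last by rewrite csM csK.
  rewrite ler0c; set h := star x * x.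
  have ph : pos h := pos_star_mul x.
  (* Here [nrm h - f h = f (scal (nrm h) - h) <= nrm (scal (nrm h) - h) <= nrm h], the last
     inequality by positivity of [h]. *)
  have := pos_dist ph (lexx _); have := fn (scal A (nrm h) - h).
  rewrite fD fN fZ f1; lra.
Qed.

End States.

(** * Limits of sequences in terms of [nrm] *)

Section SequentialLimits.
Variable R : realType.

Definition cvs (V : normedZmodType R[i]) (u : nat -> V) (l : V) :=
  forall e : R, 0 < e -> exists N, forall n, (N <= n)%N -> nrm (l - u n) <= e.

Section NormedZmod.
Variable V : normedZmodType R[i].
Implicit Types (u v : nat -> V) (l m : V).

Lemma cvs_cst l : cvs (fun=> l) l.
Proof. by move=> e e0; exists 0%N => n _; rewrite subrr nrm0 ltW. Qed.

Lemma cvs_lip (W : normedZmodType R[i]) (w : nat -> W) (k : W) (C : R) u l :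
  (forall n, nrm (l - u n) <= C * nrm (k - w n)) -> cvs w k -> cvs u l.
Proof.
move=> uw wk e e0.
have C1 : 0 < `|C| + 1 by rewrite ltr_wpDl.
have [N HN] := wk (e / (`|C| + 1)) ltac:(by rewrite divr_gt0).
exists N => n Nn; apply: le_trans (uw n) _.
apply: le_trans (_ : (`|C| + 1) * (e / (`|C| + 1)) <= _); last first.
  by rewrite mulrCA mulfV ?mulr1// gt_eqF.
apply: le_trans (_ : (`|C| + 1) * nrm (k - w n) <= _).
  apply: ler_wpM2r; first exact: nrm_ge0.
  by apply: le_trans (ler_norm _) _; rewrite lerDl.
by apply: ler_wpM2l; [exact: ltW|exact: HN].
Qed.

Lemma cvsD u v l m : cvs u l -> cvs v m -> cvs (fun n => u n + v n) (l + m).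
Proof.
move=> ul vm e e0; have e2 : 0 < e / 2 by lra.
have [N HN] := ul _ e2; have [M HM] := vm _ e2.
exists (maxn N M) => n; rewrite geq_max => /andP[/HN h1 /HM h2].
by rewrite opprD addrACA; apply: le_trans (nrmD _ _) _; lra.
Qed.

Lemma cvsN u l : cvs u l -> cvs (fun n => - u n) (- l).
Proof.
by apply: (@cvs_lip _ u l 1) => n; rewrite mul1r -opprD nrmN.
Qed.

Lemma cvsB u v l m : cvs u l -> cvs v m -> cvs (fun n => u n - v n) (l - m).
Proof. by move=> ul vm; apply: cvsD => //; exact: cvsN. Qed.

Lemma cvs_unique u l m : cvs u l -> cvs u m -> l = m.
Proof.
move=> ul um; apply/eqP; rewrite -subr_eq0; apply/eqP/nrm_small => e e0.
have [N HN] := ul (e / 2) ltac:(lra); have [M HM] := um (e / 2) ltac:(lra).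
have := HN (maxn N M) (leq_maxl _ _); have := HM (maxn N M) (leq_maxr _ _).
set x := u _ => h1 h2; apply: le_trans (nrm_distD x _ _) _.
by rewrite (nrm_distC x); lra.
Qed.

Lemma cvs_bounded u l : cvs u l ->
  exists N, forall n, (N <= n)%N -> nrm (u n) <= nrm l + 1.
Proof.
move=> /(_ 1 ltr01)[N HN]; exists N => n /HN h.
have := nrm_distn (u n) l; rewrite nrm_distC ler_norml => /andP[_]; lra.
Qed.

End NormedZmod.

Lemma cvs_bilinear (U V W : normedZmodType R[i]) (B : U -> V -> W) u v l m :
  (forall x, {morph B x : y z / y - z}) ->
  (forall y, {morph B^~ y : x z / x - z}) ->
  (forall x y, nrm (B x y) <= nrm x * nrm y) ->
  cvs u l -> cvs v m -> cvs (fun n => B (u n) (v n)) (B l m).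
Proof.
move=> Br Bl Bn ul vm e e0.
have [M HM] := cvs_bounded ul; have l0 := nrm_ge0 l; have m0 := nrm_ge0 m.
have c0 : 0 < nrm l + nrm m + 2 by lra.
have d0 : 0 < e / (nrm l + nrm m + 2) by rewrite divr_gt0.
have [N1 H1] := ul _ d0; have [N2 H2] := vm _ d0.
exists (maxn M (maxn N1 N2)) => n; rewrite !geq_max => /and3P[/HM h0 /H1 h1 /H2 h2].
have -> : B l m - B (u n) (v n) = B (l - u n) m + B (u n) (m - v n).
  by rewrite Bl Br subrKA.
apply: le_trans (nrmD _ _) _.
have b1 : nrm (B (l - u n) m) <= (e / (nrm l + nrm m + 2)) * nrm m.
  by apply: le_trans (Bn _ _) _; rewrite ler_wpM2r.
have b2 : nrm (B (u n) (m - v n)) <= (nrm l + 1) * (e / (nrm l + nrm m + 2)).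
  by apply: le_trans (Bn _ _) _; apply: ler_pM; rewrite ?nrm_ge0.
have -> : e = (e / (nrm l + nrm m + 2)) * (nrm l + nrm m + 2).
  by rewrite mulfVK// gt_eqF.
have := ltW d0; move: b1 b2; set d := e / _; nra.
Qed.

Lemma nrm_realC (r : R) : nrm r%:C = `|r|.
Proof. by rewrite /nrm normc_def/= expr0n addr0 sqrtr_sqr. Qed.

Lemma nrm_Ci : nrm ('i : R[i]) = 1.
Proof. by rewrite /nrm normc_def/= expr0n expr1n add0r sqrtr1. Qed.

Lemma nrm_Re_le (x : R[i]) : `|complex.Re x| <= nrm x.
Proof. by rewrite -lecR -nrmE normc_ge_Re. Qed.

Lemma nrmCM (x y : R[i]) : nrm (x * y) = nrm x * nrm y.
Proof. by apply: complexI; rewrite rmorphM/= -!nrmE normrM. Qed.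

Lemma cvsM (u v : nat -> R[i]) l m :
  cvs u l -> cvs v m -> cvs (fun n => u n * v n) (l * m).
Proof.
apply: (@cvs_bilinear _ _ _ *%R) => [x y z|y x z|x y].
- exact: mulrBr.
- exact: mulrBl.
- by rewrite nrmCM.
Qed.

Lemma cvs_norm (V : normedZmodType R[i]) (u : nat -> V) l :
  cvs u l -> cvs (fun n => `|u n|) `|l|.
Proof.
apply: (@cvs_lip _ _ _ _ 1) => n.
by rewrite mul1r !nrmE -rmorphB/= nrm_realC nrm_distn.
Qed.

Lemma cvsZ (V : normedModType R[i]) (k : R[i]) (u : nat -> V) l :
  cvs u l -> cvs (fun n => k *: u n) (k *: l).
Proof. by apply: (@cvs_lip _ _ _ _ (nrm k)) => n; rewrite -scalerBr nrmZ. Qed.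

Lemma cvs_complex (u : nat -> R[i]) :
  (forall e : R, 0 < e -> exists N, forall m n, (N <= m)%N -> (N <= n)%N ->
     nrm (u m - u n) <= e) ->
  exists l, cvs u l.
Proof.
move=> cu.
have cvgR (f : R[i] -> R) : (forall x y, `|f x - f y| <= nrm (x - y)) ->
    exists l, forall e : R, 0 < e ->
      exists N, forall n, (N <= n)%N -> `|l - f (u n)| <= e.
  move=> fl; have : cvg ((f \o u) @ \oo).
    apply: cauchy_cvg; apply: cauchy_exP => e e0.
    have [N HN] := cu (e / 2) ltac:(lra).
    exists (f (u N)), N => // n /= Nn; rewrite -ball_normE /=.
    apply: le_lt_trans (fl _ _) _; apply: le_lt_trans (HN _ _ _ _) _ => //; lra.
  move=> /cvg_ex[l] /cvgrPdist_le ul; exists l => e e0.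
  by have [N _ HN] := ul e e0; exists N => n Nn; exact: HN.
have nrm_sum (x : R[i]) : nrm x <= `|complex.Re x| + `|complex.Im x|.
  rewrite {1}(complexE x); apply: le_trans (nrmD _ _) _.
  by rewrite nrmCM nrm_Ci mul1r !nrm_realC.
have [|a Ha] := cvgR (@complex.Re R).
  by move=> x y; rewrite -raddfB nrm_Re_le.
have [|b Hb] := cvgR (@complex.Im R).
  move=> x y; rewrite -raddfB -normrN -ReiNIm.
  by apply: le_trans (nrm_Re_le _) _; rewrite nrmCM nrm_Ci mulr1.
exists (a +i* b) => e e0; have [N HN] := Ha (e / 2) ltac:(lra).
have [M HM] := Hb (e / 2) ltac:(lra).
exists (maxn N M) => n; rewrite geq_max => /andP[/HN h1 /HM h2].
apply: le_trans (nrm_sum _) _; move: h1 h2; case: (u n) => x y /=; lra.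
Qed.

End SequentialLimits.

(** * Semi-inner products and the Cauchy-Schwarz inequality *)

Record semiInner (R : realType) (V : lmodType R[i]) := SemiInner {
  si_form :> V -> V -> R[i];
  si_linear : forall k x y z, si_form (k *: x + y) z = k * si_form x z + si_form y z;
  si_conj : forall x y, si_form y x = conjc (si_form x y);
  si_ge0 : forall x, 0 <= si_form x x
}.

Section SemiInnerTheory.
Variables (R : realType) (V : lmodType R[i]) (s : semiInner V).
Implicit Types (x y z : V).

Definition snorm x : R := Num.sqrt (complex.Re (s x x)).

Lemma snorm_ge0 x : 0 <= snorm x. Proof. exact: sqrtr_ge0. Qed.

Lemma si_diag x : s x x = (snorm x ^+ 2)%:C.
Proof.
have := si_ge0 s x; rewrite lecE /= => /andP[/eqP h0 h1].
rewrite sqr_sqrtr// [LHS]complexE h0 mulr0 addr0//.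
Qed.

Lemma siDl x y z : s (x + y) z = s x z + s y z.
Proof. by have := si_linear s 1 x y z; rewrite scale1r mul1r. Qed.

Lemma si0l z : s 0 z = 0.
Proof.
have := siDl 0 0 z; rewrite addr0 => /eqP.
by rewrite -subr_eq0 opprD addNKr oppr_eq0 => /eqP.
Qed.

Lemma siZl k x z : s (k *: x) z = k * s x z.
Proof. by have := si_linear s k x 0 z; rewrite addr0 si0l addr0. Qed.

Lemma siNl x z : s (- x) z = - s x z.
Proof. by rewrite -scaleN1r siZl mulN1r. Qed.

Lemma siDr x y z : s x (y + z) = s x y + s x z.
Proof. by rewrite si_conj siDl rmorphD /= -!si_conj. Qed.

Lemma siZr k x z : s x (k *: z) = conjc k * s x z.
Proof. by rewrite si_conj siZl rmorphM /= -si_conj. Qed.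

Lemma siNr x z : s x (- z) = - s x z.
Proof. by rewrite si_conj siNl rmorphN /= -si_conj. Qed.

Lemma mul_conjc (z : R[i]) : z * conjc z = (nrm z ^+ 2)%:C.
Proof. by rewrite -sqr_normc nrmE rmorphXn. Qed.

Lemma cauchy_schwarz x y : nrm (s x y) <= snorm x * snorm y.
Proof.
set z := s x y; have sx := snorm_ge0 x; have sy := snorm_ge0 y; have z0 := nrm_ge0 z.
(* Expansion of [s (x - k *: y) (x - k *: y) >= 0] for [k = t z]; the factor [z] makes the cross
   terms real. *)
have key t : 0 <= snorm x ^+ 2 - 2 * t * nrm z ^+ 2 + t ^+ 2 * nrm z ^+ 2 * snorm y ^+ 2.
  rewrite -ler0c; set k := t%:C * z.
  have ck : conjc k = t%:C * conjc z.
    by rewrite rmorphM; congr (_ * _); exact: conjc_real.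
  have <- : s (x - k *: y) (x - k *: y) =
      (snorm x ^+ 2 - 2 * t * nrm z ^+ 2 + t ^+ 2 * nrm z ^+ 2 * snorm y ^+ 2)%:C.
    rewrite siDl !siDr !siNl !siNr !siZl !siZr (si_conj s x y) -/z !si_diag.
    rewrite ck /k; have := mul_conjc z.
    move: (nrm z ^+ 2) (snorm x ^+ 2) (snorm y ^+ 2) => c a b zc.
    by rewrite rmorphD rmorphB !rmorphM /= -zc rmorphMn; ring.
  exact: si_ge0.
have [y0|y0] := eqVneq (snorm y) 0.
  rewrite y0 mulr0; have [//|z1] := leP (nrm z) 0.
  (* For this [t] the right-hand side of [key] is [-1]. *)
  have := key ((snorm x ^+ 2 + 1) / (2 * nrm z ^+ 2)).
  rewrite y0 expr0n mulr0 addr0.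
  have -> : 2 * ((snorm x ^+ 2 + 1) / (2 * nrm z ^+ 2)) * nrm z ^+ 2 = snorm x ^+ 2 + 1.
    by field; rewrite gt_eqF.
  lra.
(* The value of [t] that minimizes the quadratic when [z] is nonzero. *)
have := key (snorm y ^- 2).
have -> : snorm x ^+ 2 - 2 * snorm y ^- 2 * nrm z ^+ 2 +
      snorm y ^- 2 ^+ 2 * nrm z ^+ 2 * snorm y ^+ 2 = snorm x ^+ 2 - nrm z ^+ 2 / snorm y ^+ 2 by field.
have yp : 0 < snorm y by rewrite lt_def y0.
rewrite subr_ge0 ler_pdivrMr ?exprn_gt0// -exprMn.
by rewrite ler_pXn2r// nnegrE mulr_ge0.
Qed.

End SemiInnerTheory.

(** * Hilbert space completion *)

Lemma natSinv_le (R : realType) (e : R) : 0 < e ->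
  exists N, forall n, (N <= n)%N -> n.+1%:R^-1 <= e.
Proof.
move=> e0; have [N _ HN] := near_infty_natSinv_lt (PosNum e0).
by exists N => n Nn; apply/ltW/HN.
Qed.

Section Completion.
Variables (R : realType) (V : lmodType R[i]) (s : semiInner V).

Definition approximates (f : V -> R[i]) (a : V) (e : R) : Prop :=
  forall b, nrm (f b - s a b) <= e * snorm s b.

(* The completion of [V] is realized as the space of uniform limits, on the unit
   ball, of the conjugate linear functionals [s a]. *)
Definition compl_pred : {pred V -> R[i]} := fun f =>
  `[< forall e : R, 0 < e -> exists a, approximates f a e >].

Record completion := Completion { cval : V -> R[i]; _ : cval \in compl_pred }.

HB.instance Definition _ := [isSub for cval].
HB.instance Definition _ := [Choice of completion by <:].

Lemma compl_pred_submod : GRing.subsemimod_closed compl_pred.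
Proof.
split; first split.
- apply/asboolP => e e0; exists 0 => b.
  by rewrite si0l subrr nrm0; apply: mulr_ge0; [exact: ltW|exact: snorm_ge0].
- move=> f g /asboolP Hf /asboolP Hg; apply/asboolP => e e0.
  have [a Ha] := Hf (e / 2) ltac:(lra); have [c Hc] := Hg (e / 2) ltac:(lra).
  exists (a + c) => b; rewrite siDl opprD addrACA.
  by apply: le_trans (nrmD _ _) _; have := Ha b; have := Hc b; lra.
- move=> k f /asboolP Hf; apply/asboolP => e e0.
  have k1 : 0 < nrm k + 1 by rewrite ltr_wpDl// nrm_ge0.
  have [a Ha] := Hf (e / (nrm k + 1)) ltac:(by rewrite divr_gt0).
  exists (k *: a) => b; rewrite siZl -mulrBr nrmCM.
  apply: le_trans (_ : (nrm k + 1) * (e / (nrm k + 1) * snorm s b) <= _).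
    by apply: ler_pM; rewrite ?nrm_ge0// lerDl.
  by rewrite mulrA mulrCA mulfV ?mulr1// gt_eqF.
Qed.

HB.instance Definition _ :=
  GRing.SubChoice_isSubLmodule.Build R[i] (V -> R[i]) compl_pred completion
    compl_pred_submod.

Implicit Types f g h : completion.

(** The sign condition keeps the set of bounds bounded below when [snorm s] vanishes identically;
    its infimum [hnorm] is the dual norm. *)
Definition hbound f (M : R) :=
  0 <= M /\ forall b, nrm (cval f b) <= M * snorm s b.

Definition hnorm f : R := inf [set M | hbound f M].

Lemma hbound_has_inf f : has_inf [set M | hbound f M].
Proof.
split; last by exists 0 => M [].
have [a Ha] := asboolP _ (valP f) 1 ltr01.
exists (1 + snorm s a); split; first by rewrite addr_ge0// snorm_ge0.
move=> b; rewrite -(subrK (s a b) (cval f b)) mulrDl.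
by apply: le_trans (nrmD _ _) _; apply: lerD; [exact: Ha|exact: cauchy_schwarz].
Qed.

Lemma hnorm_ge0 f : 0 <= hnorm f.
Proof. by apply: lb_le_inf; [case: (hbound_has_inf f)|move=> M []]. Qed.

Lemma hnorm_le f M : hbound f M -> hnorm f <= M.
Proof. by move=> fM; apply: ge_inf => //; case: (hbound_has_inf f). Qed.

Lemma hnormP f b : nrm (cval f b) <= hnorm f * snorm s b.
Proof.
have s0 := snorm_ge0 s b.
apply/ler_addgt0Pl => e e0.
have d0 : 0 < e / (snorm s b + 1) by rewrite divr_gt0//; lra.
have [M [M0 HM] Me] := inf_adherent d0 (hbound_has_inf f).
apply: le_trans (HM b) _.
apply: le_trans (_ : (hnorm f + e / (snorm s b + 1)) * snorm s b <= _).
  by rewrite ler_wpM2r// ltW.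
rewrite mulrDl addrC lerD2r.
rewrite -[X in _ <= X](mulfVK (x := snorm s b + 1)) ?gt_eqF//; last by lra.
by rewrite ler_wpM2l ?ltW// ltrDl.
Qed.

Lemma hnormD f g : hnorm (f + g) <= hnorm f + hnorm g.
Proof.
apply: hnorm_le; split; first by rewrite addr_ge0// hnorm_ge0.
move=> b; rewrite mulrDl; apply: le_trans (nrmD _ _) _.
by apply: lerD; exact: hnormP.
Qed.

Lemma hnormZ_le k f : hnorm (k *: f) <= nrm k * hnorm f.
Proof.
apply: hnorm_le; split; first by rewrite mulr_ge0 ?hnorm_ge0 ?nrm_ge0.
by move=> b; rewrite -[cval _ _]/(k * cval f b) nrmCM -mulrA ler_wpM2l ?nrm_ge0 ?hnormP.
Qed.

Lemma hnormZ k f : hnorm (k *: f) = nrm k * hnorm f.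
Proof.
have [->|k0] := eqVneq k 0.
  by apply/eqP; rewrite eq_le hnormZ_le nrm0 mul0r hnorm_ge0.
apply/eqP; rewrite eq_le hnormZ_le /=.
have kk : nrm k^-1 * nrm k = 1.
  by rewrite -nrmCM mulVf// -[1]/(1%:C) nrm_realC normr1.
have := hnormZ_le k^-1 (k *: f); rewrite scalerA mulVf// scale1r => h.
have := ler_wpM2l (nrm_ge0 k) h.
by rewrite mulrA [nrm k * nrm _]mulrC kk mul1r.
Qed.

Lemma hnorm0_eq0 f : hnorm f = 0 -> f = 0.
Proof.
move=> f0; apply/val_inj/funext => b; apply: nrm0_eq0; apply/eqP.
by rewrite eq_le nrm_ge0 andbT; have := hnormP f b; rewrite f0 mul0r.
Qed.

Let normH f : R[i] := (hnorm f)%:C.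
Let normHD f g : normH (f + g) <= normH f + normH g.
Proof. by rewrite /normH -rmorphD lecR hnormD. Qed.
Let normHZ k f : normH (k *: f) = `|k| * normH f.
Proof. by rewrite /normH nrmE -rmorphM hnormZ. Qed.
Let normH0 f : normH f = 0 -> f = 0.
Proof. by move=> /complexI; exact: hnorm0_eq0. Qed.

HB.instance Definition _ :=
  Lmodule_isNormed.Build R[i] completion normHD normHZ normH0.

Lemma nrm_completion f : nrm f = hnorm f.
Proof. by []. Qed.

Lemma emb_subproof a : (s a : V -> R[i]) \in compl_pred.
Proof.
apply/asboolP => e e0; exists a => b.
by rewrite subrr nrm0; apply: mulr_ge0; [exact: ltW|exact: snorm_ge0].
Qed.

Definition emb a : completion := Completion (emb_subproof a).

Lemma embD : {morph emb : a b / a + b}.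
Proof. by move=> a b; apply/val_inj/funext => c; exact: siDl. Qed.

Lemma embZ k : {morph emb : a / k *: a}.
Proof. by move=> a; apply/val_inj/funext => c; exact: siZl. Qed.

Lemma embN : {morph emb : a / - a}.
Proof. by move=> a; rewrite -scaleN1r embZ scaleN1r. Qed.

(** Cauchy-Schwarz gives one inequality, evaluation of the functional at [a] the other. *)
Lemma nrm_emb a : nrm (emb a) = snorm s a.
Proof.
apply/eqP; rewrite eq_le nrm_completion; apply/andP; split.
  by apply: hnorm_le; split; [exact: snorm_ge0|move=> b; exact: cauchy_schwarz].
have [->|a0] := eqVneq (snorm s a) 0; first exact: hnorm_ge0.
have ap : 0 < snorm s a by rewrite lt_def a0 snorm_ge0.
have := hnormP (emb a) a.
rewrite -[cval _ _]/(si_form s a a) (si_diag s a) nrm_realC.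
by rewrite ger0_norm ?sqr_ge0// expr2 ler_pM2r.
Qed.

Lemma emb_dense f : exists a : nat -> V, cvs (fun n => emb (a n)) f.
Proof.
have ex n : exists a, nrm (f - emb a) <= n.+1%:R^-1.
  have [a Ha] := asboolP _ (valP f) n.+1%:R^-1 ltac:(by rewrite invr_gt0).
  by exists a; apply: hnorm_le; split; [rewrite invr_ge0|exact: Ha].
have [a Ha] := choice ex; exists a => e e0.
have [N HN] := natSinv_le e0.
by exists N => n /HN; exact: le_trans.
Qed.

(** From a Cauchy filter one takes functionals [f n] within [1 / (n + 1)] of its members. They
    converge pointwise, uniformly relative to [snorm s], so the pointwise limit [g] is again
    approximated by vectors of [V]. *)
Let completion_complete (F : set_system completion) :
  ProperFilter F -> cauchy F -> cvg F.
Proof.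
move=> FF /cauchyP cF.
have inv0 n : (0 : R) <= n.+1%:R^-1 by rewrite invr_ge0.
have ex n : exists f, F [set g | nrm (f - g) <= n.+1%:R^-1].
  have [|f Ff] := cF (n.+1%:R^-1 : R)%:C; first by rewrite ltcR invr_gt0.
  exists f; apply: filterS Ff => g; rewrite -ball_normE /= => /ltW.
  by rewrite nrmE lecR.
have [f Hf] := choice ex.
have fdist m n : nrm (f m - f n) <= m.+1%:R^-1 + n.+1%:R^-1.
  have [g [/= h1 h2]] := filter_ex (filterI (Hf m) (Hf n)).
  by apply: le_trans (nrm_distD g _ _) _; apply: lerD => //; rewrite nrm_distC.
have fdistb m n b : nrm (cval (f m) b - cval (f n) b) <=
    (m.+1%:R^-1 + n.+1%:R^-1) * snorm s b.
  apply: le_trans (hnormP (f m - f n) b) _.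
  by rewrite ler_wpM2r ?snorm_ge0// -nrm_completion.
have [b|g Hg] := choice
    (P := fun b l => cvs (fun n => cval (f n) b) l).
  apply: cvs_complex => e e0; have sb := snorm_ge0 s b.
  have c0 : 0 < 2 * (snorm s b + 1) by lra.
  have [N HN] := natSinv_le (divr_gt0 e0 c0).
  exists N => m n /HN hm /HN hn; apply: le_trans (fdistb m n b) _.
  apply: le_trans (_ : (e / (2 * (snorm s b + 1)) + e / (2 * (snorm s b + 1))) *
    (snorm s b + 1) <= _).
    by apply: ler_pM; [rewrite addr_ge0| |rewrite lerD|rewrite lerDl].
  rewrite le_eqVlt; apply/orP; left; apply/eqP; field; lra.
have gdist n b : nrm (g b - cval (f n) b) <= n.+1%:R^-1 * snorm s b.
  have sb := snorm_ge0 s b.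
  apply/ler_addgt0Pl => e e0.
  have d0 : 0 < e / (snorm s b + 1) by rewrite divr_gt0//; lra.
  have [N HN] := natSinv_le d0; have [M HM] := Hg b _ d0.
  have := HN (maxn N M) (leq_maxl _ _); have := HM (maxn N M) (leq_maxr _ _).
  set m := maxn N M => h1 h2.
  apply: le_trans (nrm_distD (cval (f m) b) _ _) _.
  have -> : e = e / (snorm s b + 1) * (snorm s b + 1) by rewrite mulfVK//; lra.
  move: h1 h2 (fdistb m n b); set d := e / _ => h1 h2.
  have h3 := ler_wpM2r sb h2; rewrite mulrDl => h4.
  rewrite mulrDr mulr1 [d * _ + d]addrC -addrA; apply: lerD => //.
  by apply: le_trans h4 _; rewrite lerD2r.
have gP : g \in compl_pred.
  apply/asboolP => e e0.
  have [N /(_ N (leqnn N)) HN] := natSinv_le (e := e / 2) ltac:(lra).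
  have [a Ha] := asboolP _ (valP (f N)) (e / 2) ltac:(lra).
  exists a => b; apply: le_trans (nrm_distD (cval (f N) b) _ _) _.
  have -> : e * snorm s b = e / 2 * snorm s b + e / 2 * snorm s b by field.
  apply: lerD; last exact: Ha.
  by apply: le_trans (gdist N b) _; rewrite ler_wpM2r ?snorm_ge0.
apply/cvg_ex; exists (Completion gP); apply/cvgrPdist_le => e e0.
have [r -> r0] := gt0_real_complex e0.
have [N /(_ N (leqnn N)) HN] := natSinv_le (e := r / 2) ltac:(lra).
near=> h; rewrite nrmE lecR; apply: le_trans (nrm_distD (f N) _ _) _.
have h1 : nrm (f N - h) <= N.+1%:R^-1 by near: h; exact: Hf.
have h2 : nrm (Completion gP - f N) <= N.+1%:R^-1.
  by apply: hnorm_le; split => //; exact: gdist.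
by rewrite (splitr r); apply: lerD; [exact: le_trans h2 HN|exact: le_trans h1 HN].
Unshelve. all: by end_near. Qed.

HB.instance Definition _ := Uniform_isComplete.Build completion completion_complete.
End Completion.

(** * The inner product of the completion *)

Section InnerProduct.
Variables (R : realType) (V : lmodType R[i]) (s : semiInner V).
Local Notation H := (completion s).
Implicit Types f g h : H.

(** The polarization formula. Being defined from the norm it is continuous, so its algebraic laws
    extend from the dense image of [V]. *)
Definition hdot f g : R[i] :=
  4^-1 * (`|f + g| ^+ 2 - `|f - g| ^+ 2 +
          'i * (`|f + 'i *: g| ^+ 2 - `|f - 'i *: g| ^+ 2)).

Lemma hdot_emb a b : hdot (emb s a) (emb s b) = s a b.
Proof.
have sq x : `|emb s x| ^+ 2 = s x x.
  by rewrite nrmE nrm_emb si_diag rmorphXn.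
rewrite /hdot -embZ -!embN -!embD !sq.
rewrite !siDl !siDr !siNl !siNr !siZl !siZr.
have -> : conjc ('i : R[i]) = - 'i by apply/eqP; rewrite eq_complex /= oppr0 !eqxx.
have ii : 'i * 'i = -1 :> R[i] by rewrite -expr2 sqr_i.
set x := s a b; set y := s b a; set z := s a a; set w := s b b.
transitivity (4^-1 * (2 * (x + y) - 2 * ('i * 'i) * (x - y))); first by ring.
by rewrite ii; field.
Qed.

Lemma hdot_cvs (u v : nat -> H) f g : cvs u f -> cvs v g ->
  cvs (fun n => hdot (u n) (v n)) (hdot f g).
Proof.
move=> uf vg.
have sq (w : nat -> H) h : cvs w h -> cvs (fun n => `|w n| ^+ 2) (`|h| ^+ 2).
  move=> wh; under eq_fun do rewrite expr2.
  by rewrite expr2; apply: cvsM; exact: cvs_norm.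
apply: cvsM; first exact: cvs_cst.
apply: cvsD; first by apply: cvsB; apply: sq; [exact: cvsD|exact: cvsB].
apply: cvsM; first exact: cvs_cst.
by apply: cvsB; apply: sq; [apply: cvsD|apply: cvsB] => //; exact: cvsZ.
Qed.

Lemma cvs_conj (u : nat -> R[i]) l : cvs u l -> cvs (fun n => conjc (u n)) (conjc l).
Proof.
by apply: (@cvs_lip _ _ _ _ _ 1) => n; rewrite mul1r -rmorphB /nrm normcJ.
Qed.

Lemma hdot_linear k f g h : hdot (k *: f + g) h = k * hdot f h + hdot g h.
Proof.
have [a fa] := emb_dense f; have [b gb] := emb_dense g; have [c hc] := emb_dense h.
have h1 := hdot_cvs (cvsD (cvsZ k fa) gb) hc.
apply: (cvs_unique h1).
under eq_fun do rewrite -embZ -embD hdot_emb siDl siZl -!hdot_emb.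
by apply: cvsD; [apply: cvsM; [exact: cvs_cst|]|]; exact: hdot_cvs.
Qed.

Lemma hdot_conj f g : hdot f g = Num.conj (hdot g f).
Proof.
have [a fa] := emb_dense f; have [b gb] := emb_dense g.
apply: (cvs_unique (hdot_cvs fa gb)).
under eq_fun do rewrite hdot_emb si_conj -hdot_emb.
by apply: cvs_conj; exact: hdot_cvs.
Qed.

Lemma hdot_norm f : hdot f f = `|f| ^+ 2.
Proof.
have [a fa] := emb_dense f; apply: (cvs_unique (hdot_cvs fa fa)).
have sq b : hdot (emb s b) (emb s b) = `|emb s b| * `|emb s b|.
  by rewrite hdot_emb si_diag nrmE nrm_emb -rmorphM expr2.
under eq_fun do rewrite sq.
by rewrite expr2; apply: cvsM; exact: cvs_norm.
Qed.

Let hdotBl g : zmod_morphism (hdot^~ g).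
Proof. by move=> f h; rewrite addrC -scaleN1r hdot_linear mulN1r addrC. Qed.
Let hdotZl g : scalable_for *%R (hdot^~ g).
Proof.
move=> k f; have hdot0 : hdot 0 g = 0 by rewrite -(subrr f) hdotBl subrr.
by have := hdot_linear k f 0 g; rewrite !addr0 hdot0 addr0.
Qed.
Let hdotBr f : zmod_morphism (hdot f).
Proof. by move=> g h; rewrite !(hdot_conj f) hdotBl rmorphB. Qed.
Let hdotZr f : scalable_for (@Num.conj R[i] \; *%R) (hdot f).
Proof. by move=> k g; rewrite !(hdot_conj f) hdotZl rmorphM. Qed.

HB.instance Definition _ := @isBilinear.Build R[i] H H R[i]
  *%R (@Num.conj R[i] \; *%R) hdot hdotBl hdotBr hdotZl hdotZr.

Let hdot_herm f g : hdot f g = (-1) ^+ false * Num.conj (hdot g f).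
Proof. by rewrite expr0 mul1r hdot_conj. Qed.

HB.instance Definition _ :=
  @isHermitianSesquilinear.Build R[i] H false (@Num.conj R[i]) hdot hdot_herm.

Let hdot_gt0 f : f != 0 -> 0 < hdot f f.
Proof. by move=> f0; rewrite hdot_norm exprn_gt0// normr_gt0. Qed.

HB.instance Definition _ := @isDotProduct.Build R[i] H hdot hdot_gt0.

HB.instance Definition _ := @NormedModule_isHilbert.Build R[i] H
  (hdot : {dot H for @Num.conj R[i]}) hdot_norm.

End InnerProduct.

Lemma lipschitz_continuous_nrm (R : realType) (V W : normedModType R[i])
    (f : V -> W) (M : R) :
  0 <= M -> (forall x y, nrm (f x - f y) <= M * nrm (x - y)) -> continuous f.
Proof.
move=> M0 Hf x; have M1 : 0 < M + 1 by rewrite ltr_wpDl.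
have M1C : 0 < (M + 1)%:C by rewrite ltcR.
apply/cvgrPdist_lt => e e0; near=> y.
apply: (@le_lt_trans _ _ ((M + 1)%:C * `|x - y|)).
  rewrite !nrmE -rmorphM lecR; apply: le_trans (Hf x y) _.
  by rewrite ler_wpM2r ?nrm_ge0// lerDl.
rewrite mulrC -ltr_pdivlMr//.
by near: y; apply: cvgr_dist_lt; [exact: cvg_id|rewrite divr_gt0].
Unshelve. all: by end_near. Qed.

(** Provides a self-adjoint [z] with [z * z = nrm x ^+ 2 - star x * x], from which the bounds on
    representations and on the GNS form follow. *)
Lemma pos_norm_sub (R : realType) (A : cstarType R[i]) (x : A) :
  pos (scal A (nrm x ^+ 2) - star x * x).
Proof.
apply: (@dist_pos _ _ _ (nrm x ^+ 2)); first by rewrite csB scal_sa csM csK.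
by rewrite opprB addrC subrK nrm_id.
Qed.

(** * Contractivity of representations *)

Section Contractive.
Variables (R : realType) (A : cstarType R[i]) (H : hilbertType R[i]).
Variable pi : A -> {linear H -> H}.
Hypothesis rpi : is_unital_rep pi.

Lemma dotp_nrm (x : H) : dotp x x = (nrm x ^+ 2)%:C.
Proof. by rewrite dotp_norm nrmE rmorphXn. Qed.

(** With [z * z = nrm a ^+ 2 - star a * a], the square of [nrm (pi a x)] is that of [nrm a * nrm x]
    minus that of [nrm (pi z x)]. *)
Lemma rep_contractive a x : nrm (pi a x) <= nrm a * nrm x.
Proof.
have [z sz zz] := pos_norm_sub a.
have eq1 : pi (star a * a) x = (nrm a ^+ 2)%:C *: x - pi z (pi z x).
  have -> : star a * a = (- (1 : R[i])) *: (z * z) + scal A (nrm a ^+ 2).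
    by rewrite -zz scaleN1r opprB subrK.
  rewrite (rep_linear rpi) scaleN1r (rep_mul rpi) addrC; congr (_ - _).
  have := rep_linear rpi (nrm a ^+ 2)%:C 1 0 x.
  have -> : pi 0 x = 0.
    by have := rep_linear rpi (-1) 0 0 x; rewrite scaler0 addr0 scaleN1r addNr.
  by rewrite !addr0 (rep_one rpi).
have eq2 : (nrm (pi a x) ^+ 2)%:C = ((nrm a * nrm x) ^+ 2)%:C - (nrm (pi z x) ^+ 2)%:C.
  have e1 : dotp (pi a x) (pi a x) = dotp x (pi (star a * a) x).
    by rewrite (rep_mul rpi); exact: rep_star.
  have e2 : dotp (pi z x) (pi z x) = dotp x (pi z (pi z x)).
    by rewrite -{3}sz; exact: rep_star.
  rewrite exprMn (real_complexM (nrm a ^+ 2)) -!dotp_nrm e1 e2 eq1 linearBr linearZr_LR.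
  congr (_ * _ - _); exact: conjc_real.
have : nrm (pi a x) ^+ 2 <= (nrm a * nrm x) ^+ 2.
  by rewrite -lecR eq2 gerBl ler0c sqr_ge0.
by rewrite ler_pXn2r// nnegrE ?mulr_ge0 ?nrm_ge0.
Qed.

End Contractive.

(** * The GNS representation *)

Section GNS.
Variables (R : realType) (A : cstarType R[i]) (phi : A -> R[i]).
Hypothesis hphi : positive_functional phi.

Let phi0 : phi 0 = 0.
Proof. by have := pf_linear hphi (-1) 0 0; rewrite scaler0 addr0 mulN1r addNr. Qed.

Let form_linear k x y z :
  phi (star z * (k *: x + y)) = k * phi (star z * x) + phi (star z * y).
Proof. by rewrite mulrDr csMZr (pf_linear hphi). Qed.

Let form_conj x y : phi (star x * y) = conjc (phi (star y * x)).
Proof. by rewrite -(pf_star hphi) csM csK. Qed.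

Definition gns_form : semiInner A :=
  @SemiInner R A (fun x y => phi (star y * x)) form_linear form_conj
    (fun x => pf_ge0 hphi x).

Local Notation H := (completion gns_form).

(** The computation of [rep_contractive], with left multiplication in place of [pi] and the seminorm
    in place of the norm. *)
Lemma gns_form_bounded x a : snorm gns_form (x * a) <= nrm x * snorm gns_form a.
Proof.
have [z sz zz] := pos_norm_sub x.
have xx : star x * x = scal A (nrm x ^+ 2) - z * z by rewrite -zz subKr.
have eq1 : star (x * a) * (x * a) =
    (nrm x ^+ 2)%:C *: (star a * a) - star (z * a) * (z * a).
  rewrite !csM sz -!mulrA (mulrA (star x)) xx mulrBl mulrBr scal_mull csMZr.
  by rewrite !mulrA.
have eq2 : ((snorm gns_form (x * a)) ^+ 2)%:C =
    ((nrm x * snorm gns_form a) ^+ 2)%:C - ((snorm gns_form (z * a)) ^+ 2)%:C.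
  rewrite exprMn (real_complexM (nrm x ^+ 2)) -!si_diag /= eq1 (pf_linear hphi); congr (_ + _).
  by rewrite -scaleN1r -[_ *: _]addr0 (pf_linear hphi) mulN1r phi0 addr0.
have : snorm gns_form (x * a) ^+ 2 <= (nrm x * snorm gns_form a) ^+ 2.
  by rewrite -lecR eq2 gerBl ler0c sqr_ge0.
by rewrite ler_pXn2r// nnegrE ?mulr_ge0 ?nrm_ge0 ?snorm_ge0.
Qed.

Lemma gns_approx x (f : A -> R[i]) a e : 0 <= e -> approximates gns_form f a e ->
  approximates gns_form (fun b => f (star x * b)) (x * a) (nrm x * e).
Proof.
move=> e0 fa b.
have -> : gns_form (x * a) b = gns_form a (star x * b).
  by rewrite /gns_form /= csM csK mulrA.
apply: le_trans (fa _) _; rewrite [nrm x * e]mulrC -mulrA ler_wpM2l//.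
by apply: le_trans (gns_form_bounded _ _) _; rewrite nrm_star.
Qed.

Lemma gns_op_subproof x (f : H) :
  (fun b => cval f (star x * b)) \in compl_pred gns_form.
Proof.
apply/asboolP => e e0.
have x1 : 0 < nrm x + 1 by rewrite ltr_wpDl// nrm_ge0.
have d0 : 0 < e / (nrm x + 1) by rewrite divr_gt0.
have [a Ha] := asboolP _ (valP f) _ d0.
exists (x * a) => b; apply: le_trans (@gns_approx x _ _ _ (ltW d0) Ha b) _.
rewrite ler_wpM2r ?snorm_ge0// -[X in _ <= X](mulfVK (x := nrm x + 1)) ?gt_eqF//.
by rewrite mulrC ler_wpM2l ?(ltW d0)// lerDl.
Qed.

(** Left multiplication by [x] has left multiplication by [star x] as adjoint for [gns_form], so on
    functionals it is precomposition with the latter; see [gns_op_emb]. *)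
Definition gns_op x (f : H) : H := Completion (gns_op_subproof x f).

Let gns_op_linear x : linear (gns_op x).
Proof. by move=> k f g; apply/val_inj/funext. Qed.

HB.instance Definition _ x :=
  GRing.isLinear.Build R[i] H H *:%R (gns_op x) (gns_op_linear x).

Lemma nrm_gns_op x f : nrm (gns_op x f) <= nrm x * nrm f.
Proof.
apply: hnorm_le; split; first by rewrite mulr_ge0 ?nrm_ge0.
move=> b; apply: le_trans (hnormP f _) _.
rewrite -nrm_completion [nrm x * _]mulrC -mulrA ler_wpM2l ?nrm_ge0//.
by apply: le_trans (gns_form_bounded _ _) _; rewrite nrm_star.
Qed.

Lemma gns_op_emb x a : gns_op x (emb gns_form a) = emb gns_form (x * a).
Proof. by apply/val_inj/funext => b; rewrite /= csM csK mulrA. Qed.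

Lemma gns_op_cvs x u (f : H) : cvs u f -> cvs (fun n => gns_op x (u n)) (gns_op x f).
Proof.
by apply: (@cvs_lip _ _ _ _ _ (nrm x)) => n; rewrite -linearB nrm_gns_op.
Qed.

Lemma gns_rep : is_unital_rep (fun x => gns_op x : {linear H -> H}).
Proof.
split.
- move=> x; apply: (@lipschitz_continuous_nrm _ _ _ _ (nrm x)); first exact: nrm_ge0.
  by move=> f g; rewrite -linearB nrm_gns_op.
- move=> k x y f; have [a fa] := emb_dense f.
  apply: (cvs_unique (@gns_op_cvs _ _ _ fa)).
  under eq_fun do rewrite /= gns_op_emb mulrDl csMZl embD embZ -!gns_op_emb.
  by apply: cvsD; [apply: cvsZ|]; exact: gns_op_cvs.
- by move=> x y f; apply/val_inj/funext => b; rewrite /= csM mulrA.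
- by move=> f; apply/val_inj/funext => b; rewrite /= cs_star1 mul1r.
- move=> x f g; have [a fa] := emb_dense f; have [b gb] := emb_dense g.
  rewrite -[LHS]/(hdot _ _) -[RHS]/(hdot _ _).
  apply: (cvs_unique (hdot_cvs (@gns_op_cvs _ _ _ fa) gb)).
  have sw m n : hdot (gns_op x (emb gns_form m)) (emb gns_form n) =
      hdot (emb gns_form m) (gns_op (star x) (emb gns_form n)).
    by rewrite !gns_op_emb !hdot_emb /= csM csK mulrA.
  under eq_fun do rewrite sw.
  by apply: hdot_cvs => //; exact: gns_op_cvs.
Qed.

End GNS.

(** In the GNS representation of a state norming [star c * c], the vector is the class of [1], and
    [nrm (pi c xi) ^+ 2] is the value of the state at [star c * c]. *)
Lemma norming_rep (R : realType) (A : cstarType R[i]) (c : A) : c != 0 ->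
  exists (H : hilbertType R[i]) (pi : A -> {linear H -> H}) (xi : H),
    [/\ is_unital_rep pi, nrm xi = 1 & nrm (pi c xi) = nrm c].
Proof.
move=> /norming_state[phi [hphi phi1 phic]].
exists (completion (gns_form hphi)), (fun x => gns_op x), (emb (gns_form hphi) 1).
split; first exact: gns_rep.
- by rewrite nrm_emb /snorm /= cs_star1 mul1r phi1 sqrtr1.
- by rewrite /= gns_op_emb mulr1 nrm_emb /snorm /= phic /= sqrtr_sqr ger0_norm ?nrm_ge0.
Qed.

(** * Closures by sequences, and pullbacks of representations *)

Section Closure.
Variable R : realType.

Lemma closure_cvs (V : normedModType R[i]) (X : set V) x : closure X x ->
  exists2 u : nat -> V, forall n, X (u n) & cvs u x.
Proof.
move=> Xx; have ex n : exists y, X y /\ nrm (x - y) <= n.+1%:R^-1.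
  have n0 : 0 < (n.+1%:R^-1 : R)%:C by rewrite ltcR invr_gt0.
  have [y [Xy]] := Xx _ (nbhsx_ballx x _ n0).
  by rewrite -ball_normE /= nrmE ltcR => /ltW; exists y.
have [u Hu] := choice ex; exists u => [n|e e0]; first by case: (Hu n).
have [N HN] := natSinv_le e0; exists N => n /HN; apply: le_trans.
by case: (Hu n).
Qed.

Lemma closed_cvs (V : normedModType R[i]) (X : set V) (u : nat -> V) x :
  closed X -> (forall n, X (u n)) -> cvs u x -> X x.
Proof.
move=> cX Xu ux; rewrite [X](proj1 (closure_id _) cX) => U.
rewrite -nbhs_ballE => -[e /= e0 eU].
have [r er r0] := gt0_real_complex e0.
have [N /(_ N (leqnn N)) HN] := ux (r / 2) ltac:(lra).
exists (u N); split => //; apply: eU; rewrite -ball_normE /= er nrmE ltcR.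
by apply: le_lt_trans HN _; lra.
Qed.

Lemma cvs_cstarM (A : cstarType R[i]) (u v : nat -> A) x y :
  cvs u x -> cvs v y -> cvs (fun n => u n * v n) (x * y).
Proof.
apply: (@cvs_bilinear R A A A *%R) => [a b d|a b d|a b].
- exact: mulrBr.
- exact: mulrBl.
- exact: nrmM.
Qed.

Lemma cvs_star (A : cstarType R[i]) (u : nat -> A) x :
  cvs u x -> cvs (fun n => star (u n)) (star x).
Proof.
by apply: (@cvs_lip _ _ _ _ _ 1) => n; rewrite mul1r -csB nrm_star.
Qed.

End Closure.

Section Representations.
Variables (R : realType) (A : cstarType R[i]) (H : hilbertType R[i]).
Variable pi : A -> {linear H -> H}.
Hypothesis rpi : is_unital_rep pi.

Lemma rep_isometry w : star w * w = 1 -> is_isometry (pi w).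
Proof.
move=> ww x; have : dotp (pi w x) (pi w x) = dotp x x.
  rewrite -[X in _ = dotp _ X](rep_one rpi) -ww (rep_mul rpi); exact: rep_star.
by rewrite !dotp_norm => /eqP; rewrite eqrXn2// => /eqP.
Qed.

Lemma rep_comp (A' : cstarType R[i]) (f : A' -> A) :
  is_star_hom f -> f 1 = 1 -> is_unital_rep (fun a => pi (f a)).
Proof.
move=> [fl fm fs] f1; split=> [a|k a b x|a b x|x|a].
- exact: rep_continuous.
- by rewrite fl (rep_linear rpi).
- by rewrite fm (rep_mul rpi).
- by rewrite f1 (rep_one rpi).
- by rewrite fs; exact: rep_star.
Qed.

End Representations.

(** A representation norming [f x] pulls back along [f] to a representation of [A], which is
    contractive. *)
Lemma star_hom_contractive (R : realType) (A B : cstarType R[i]) (f : A -> B) x :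
  is_star_hom f -> f 1 = 1 -> nrm (f x) <= nrm x.
Proof.
move=> hf f1; have [->|fx] := eqVneq (f x) 0; first by rewrite nrm0 nrm_ge0.
have [H [pi [xi [rpi xi1 <-]]]] := norming_rep fx.
have rf := rep_comp rpi hf f1.
by have := rep_contractive rf x xi; rewrite xi1 mulr1.
Qed.

(** * Isomorphisms from matching representations *)

Section GeneratedIsomorphism.
Variables (R : realType) (T : Type).

(* The graph of the isomorphism on the *-algebras generated by [b] and [c]. *)
Inductive generated_pair (B C : cstarType R[i]) (b : T -> B) (c : T -> C) :
    B -> C -> Prop :=
| GPgen t : generated_pair b c (b t) (c t)
| GPone : generated_pair b c 1 1
| GPlin k x y x' y' : generated_pair b c x x' -> generated_pair b c y y' ->
    generated_pair b c (k *: x + y) (k *: x' + y')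
| GPmul x y x' y' : generated_pair b c x x' -> generated_pair b c y y' ->
    generated_pair b c (x * y) (x' * y')
| GPstar x x' : generated_pair b c x x' -> generated_pair b c (star x) (star x').

(** This is what the universal property of [B] will supply; it makes the norm of [B] dominate that
    of [C] on matching elements. *)
Definition reps_transfer (B C : cstarType R[i]) (b : T -> B) (c : T -> C) : Prop :=
  forall (H : hilbertType R[i]) (sigma : C -> {linear H -> H}),
  is_unital_rep sigma -> exists rho : B -> {linear H -> H},
    is_unital_rep rho /\ forall t x, rho (b t) x = sigma (c t) x.

Lemma generated_pair_sym (B C : cstarType R[i]) (b : T -> B) (c : T -> C) x y :
  generated_pair b c x y -> generated_pair c b y x.
Proof.
by elim=> *; [exact: GPgen|exact: GPone|exact: GPlin|exact: GPmul|exact: GPstar].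
Qed.

Lemma adjoint_unique (H : hilbertType R[i]) (U U1 U2 : H -> H) :
  is_adjoint U U1 -> is_adjoint U U2 -> forall x, U1 x = U2 x.
Proof.
move=> h1 h2 x; set d := U1 x - U2 x.
have : dotp d d = 0.
  rewrite {2}/d linearBr; apply/eqP; rewrite subr_eq0; apply/eqP.
  exact: etrans (esym (h1 d x)) (h2 d x).
rewrite dotp_norm => /eqP; rewrite expf_eq0 /= normr_eq0 subr_eq0.
by move/eqP.
Qed.

(** A representation [sigma] norming [y] transfers to some [rho]; by induction on the pair [rho x]
    and [sigma y] agree, and [rho] is contractive. *)
Lemma generated_pair_le (B C : cstarType R[i]) (b : T -> B) (c : T -> C) x y :
  reps_transfer b c -> generated_pair b c x y -> nrm y <= nrm x.
Proof.
move=> tr xy; have [->|y0] := eqVneq y 0; first by rewrite nrm0 nrm_ge0.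
have [H [sigma [xi [rs xi1 <-]]]] := norming_rep y0.
have [rho [rr rt]] := tr H sigma rs.
suff <- : rho x xi = sigma y xi.
  by have := rep_contractive rr x xi; rewrite xi1 mulr1.
elim: xy xi {xi1 y0} => {x y}
  [t|| k x y x' y' _ IHx _ IHy|x y x' y' _ IHx _ IHy|x x' _ IHx] z.
- exact: rt.
- by rewrite (rep_one rr) (rep_one rs).
- by rewrite (rep_linear rr) (rep_linear rs) IHx IHy.
- by rewrite (rep_mul rr) (rep_mul rs) IHy IHx.
(* Both operators are adjoints of [rho x], which equals [sigma x'] by induction. *)
- apply: (@adjoint_unique _ (rho x)); first exact: rep_star.
  by move=> u v; rewrite IHx; exact: rep_star.
Qed.

Section Extension.
Variables (B C : cstarType R[i]) (b : T -> B) (c : T -> C).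
Hypothesis iso : forall x y, generated_pair b c x y -> nrm x = nrm y.

(** The closure of the graph [generated_pair]; under [iso] it is the graph of an isometry. *)
Definition closed_pair (x : B) (y : C) : Prop := exists u v,
  [/\ forall n, generated_pair b c (u n) (v n), cvs u x & cvs v y].

Lemma closed_pair_nrm x y : closed_pair x y -> nrm x = nrm y.
Proof.
move=> [u [v [uv ux vy]]]; apply: complexI; rewrite -!nrmE.
apply: (cvs_unique (cvs_norm ux)).
under eq_fun do rewrite nrmE (iso (uv _)) -nrmE.
exact: cvs_norm.
Qed.

Lemma closed_pair_gen t : closed_pair (b t) (c t).
Proof.
by exists (fun=> b t), (fun=> c t); split; [move=> _; exact: GPgen|exact: cvs_cst..].
Qed.

Lemma closed_pair_lin k x y x' y' : closed_pair x x' -> closed_pair y y' ->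
  closed_pair (k *: x + y) (k *: x' + y').
Proof.
move=> [u [u' [uu ux ux']]] [v [v' [vv vy vy']]].
exists (fun n => k *: u n + v n), (fun n => k *: u' n + v' n).
by split; [move=> n; exact: GPlin| |]; apply: cvsD => //; exact: cvsZ.
Qed.

Lemma closed_pair_mul x y x' y' : closed_pair x x' -> closed_pair y y' ->
  closed_pair (x * y) (x' * y').
Proof.
move=> [u [u' [uu ux ux']]] [v [v' [vv vy vy']]].
exists (fun n => u n * v n), (fun n => u' n * v' n).
by split; [move=> n; exact: GPmul| |]; exact: cvs_cstarM.
Qed.

Lemma closed_pair_star x x' : closed_pair x x' -> closed_pair (star x) (star x').
Proof.
move=> [u [u' [uu ux ux']]].
exists (fun n => star (u n)), (fun n => star (u' n)).
by split; [move=> n; exact: GPstar| |]; exact: cvs_star.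
Qed.

(** The difference of two partners of [x] is paired with [0], and pairs have equal norms. *)
Lemma closed_pair_fun x y y' : closed_pair x y -> closed_pair x y' -> y = y'.
Proof.
move=> xy xy'; have := closed_pair_nrm (closed_pair_lin (-1) xy' xy).
rewrite !scaleN1r addNr nrm0 => /esym/nrm0_eq0 /eqP.
by rewrite addrC subr_eq0 => /eqP.
Qed.

(** The elements with a partner form a *-subalgebra containing the generators, hence a dense one.
    The partners of a convergent sequence are Cauchy by [iso], so they converge too. *)
Lemma closed_pair_total : cstar_generates (range b) ->
  forall x, exists y, closed_pair x y.
Proof.
move=> genb x; pose D := [set x | exists y, generated_pair b c x y].
have subD : star_subalgebra D.
  split.
  - by exists 1; exact: GPone.
  - by move=> k y z [y' Dy] [z' Dz]; exists (k *: y' + z'); exact: GPlin.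
  - by move=> y z [y' Dy] [z' Dz]; exists (y' * z'); exact: GPmul.
  - by move=> y [y' Dy]; exists (star y'); exact: GPstar.
have DT : closure D = setT.
  apply: genb; [exact: closure_star_subalgebra|exact: closed_closure|].
  by move=> _ [t _ <-]; apply: subset_closure; exists (c t); exact: GPgen.
have [u Du ux] : exists2 u : nat -> B, forall n, D (u n) & cvs u x.
  by apply: closure_cvs; rewrite DT.
have [v uv] := choice Du.
have [y vy] : exists y, cvs v y.
  apply: nrm_complete => e e0; have [N HN] := ux (e / 2) ltac:(lra).
  exists N => m n /HN hm /HN hn.
  have := iso (GPlin (-1) (uv n) (uv m)); rewrite !scaleN1r addrC [- v n + _]addrC => <-.
  apply: le_trans (nrm_distD x _ _) _; rewrite nrm_distC.
  by rewrite (splitr e); exact: lerD.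
by exists y, u, v.
Qed.

End Extension.

(** The closed graph is symmetric in [b] and [c], so the map built with the roles exchanged is the
    inverse. *)
Lemma generated_iso (B C : cstarType R[i]) (b : T -> B) (c : T -> C) :
  cstar_generates (range b) -> cstar_generates (range c) ->
  reps_transfer b c -> reps_transfer c b ->
  exists Phi : B -> C,
    [/\ is_star_hom Phi, bijective Phi & forall t, Phi (b t) = c t].
Proof.
move=> genb genc bc cb.
have iso x y : generated_pair b c x y -> nrm x = nrm y.
  move=> xy; apply/eqP; rewrite eq_le (generated_pair_le bc xy) andbT.
  exact: generated_pair_le cb (generated_pair_sym xy).
have iso' x y : generated_pair c b x y -> nrm x = nrm y.
  by move/generated_pair_sym/iso.
have [Phi HPhi] := choice (closed_pair_total iso genb).
have [Psi HPsi] := choice (closed_pair_total iso' genc).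
have sym x y : closed_pair b c x y -> closed_pair c b y x.
  by move=> [u [v [uv ux vy]]]; exists v, u; split => // n; exact: generated_pair_sym.
have sym' x y : closed_pair c b x y -> closed_pair b c y x.
  by move=> [u [v [uv ux vy]]]; exists v, u; split => // n; exact: generated_pair_sym.
exists Phi; split; first split.
- by move=> k x y; apply: (closed_pair_fun iso (HPhi _)); exact: closed_pair_lin.
- by move=> x y; apply: (closed_pair_fun iso (HPhi _)); exact: closed_pair_mul.
- by move=> x; apply: (closed_pair_fun iso (HPhi _)); exact: closed_pair_star.
- exists Psi => x.
    by apply: (closed_pair_fun iso' (HPsi _)); exact/sym/HPhi.
  by apply: (closed_pair_fun iso (HPhi _)); exact/sym'/HPsi.
- by move=> t; apply: (closed_pair_fun iso (HPhi _)); exact: closed_pair_gen.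
Qed.

End GeneratedIsomorphism.

(** * Crossed products *)

Section CrossedProducts.
Variables (R : realType) (S : monoidType) (A B : cstarType R[i]).
Variables (alpha : S -> A -> A) (iA : A -> B) (iS : S -> B).
Hypotheses (hO : left_ore S) (hun : unital_action alpha).
Hypothesis hB : is_crossed_product alpha iA iS.
Variables (G : groupType) (iota : S -> G) (hG : is_enveloping_group iota).
Local Notation D := (SAS hO hun hB).

Lemma iS_one : iS 1%g = 1.
Proof.
have := congr1 (fun z => star (iS 1%g) * z) (iS_mul hB 1%g 1%g).
by rewrite mulg1 mulrA (iS_isometry hB) mul1r.
Qed.

Lemma SAS_iA a : SAS_set iA iS (iA a).
Proof.
by apply: subset_closure; exists 1%g, a; rewrite iS_one cs_star1 mul1r mulr1.
Qed.

Definition iA_SAS (a : A) : D :=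
  @csub_mk R[i] B (SAS_subalg hO hun hB) _ (@SAS_iA a).

Lemma iA_SAS_hom : is_star_hom iA_SAS.
Proof.
have [l m st] := cp_hom hB.
split=> [k x y|x y|x]; apply: csub_incl_inj; rewrite /csub_incl /=.
- exact: l.
- exact: m.
- exact: st.
Qed.

Lemma iA_SAS1 : iA_SAS 1 = 1.
Proof. by apply: csub_incl_inj; rewrite /csub_incl /= (cp_unital hB). Qed.

Lemma csub_incl_hom : is_star_hom (@csub_incl R[i] B (SAS_subalg hO hun hB)).
Proof. by split. Qed.

Lemma iA_SAS_alpha t a : iA_SAS (alpha t a) = alphabarG hO hun hB hG (iota t) (iA_SAS a).
Proof.
rewrite alphabarG_iota; apply: csub_incl_inj; rewrite /csub_incl /=.
exact: (cp_conj hB).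
Qed.

(** The Ore condition brings both fractions to a common denominator, and a common left factor [iS w]
    cancels because it is an isometry. *)
Lemma iS_frac_eq s t s1 t1 :
  ((iota s)^-1 * iota t = (iota s1)^-1 * iota t1)%g ->
  star (iS s) * iS t = star (iS s1) * iS t1.
Proof.
move=> e; have [p [q e1]] := hO s1 s.
have e2 : (p * t = q * t1)%g.
  apply: (env_inj hG); rewrite !(env_mul hG).
  have -> : iota t = (iota s * ((iota s)^-1 * iota t))%g by rewrite mulVKg.
  by rewrite e !mulgA -(env_mul hG p s) e1 (env_mul hG q s1) mulgK.
have frac u v w : star (iS u) * iS v = star (iS (w * u)%g) * iS (w * v)%g.
  rewrite !(iS_mul hB) csM !mulrA -[_ * star (iS w) * iS w]mulrA.
  by rewrite (iS_isometry hB) mulr1.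
by rewrite (frac s t p) (frac s1 t1 q) e1 e2.
Qed.

Lemma iS_group_ext : exists w : G -> B,
  forall s t, w ((iota s)^-1 * iota t)%g = star (iS s) * iS t.
Proof.
have ex g : exists x, forall s t, g = ((iota s)^-1 * iota t)%g ->
    x = star (iS s) * iS t.
  have [s [t gst]] := env_frac hG g; exists (star (iS s) * iS t) => s1 t1 g1.
  by apply: iS_frac_eq; rewrite -gst.
by have [w Hw] := choice ex; exists w => s t; exact: Hw.
Qed.

Lemma env_frac_mul s t p q t' p' : (t' * p = p' * t)%g ->
  ((iota s)^-1 * iota t * ((iota p)^-1 * iota q) =
   (iota (p' * s))^-1 * iota (t' * q))%g.
Proof.
move=> e.
have e2 : (iota t * (iota p)^-1 = (iota p')^-1 * iota t')%g.
  apply: (mulgI (iota p')); rewrite mulVKg mulgA -(env_mul hG) -e.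
  by rewrite (env_mul hG) mulgK.
by rewrite !(env_mul hG) invgM !mulgA -[((iota s)^-1 * _ / _)%g]mulgA e2 !mulgA.
Qed.

(** * The extension of [iS] to a unitary representation of [G] *)

Section Extension.
Variable w : G -> B.
Hypothesis hw : forall s t, w ((iota s)^-1 * iota t)%g = star (iS s) * iS t.

Lemma ext_iota s : w (iota s) = iS s.
Proof.
have -> : iota s = ((iota 1)^-1 * iota s)%g by rewrite (env_one hG) invg1 mul1g.
by rewrite hw iS_one cs_star1 mul1r.
Qed.

Lemma ext_mul g h : w (g * h)%g = w g * w h.
Proof.
have [s [t ->]] := env_frac hG g; have [p [q ->]] := env_frac hG h.
have [p' [t' e]] := hO p t.
rewrite (env_frac_mul s q (esym e)) !hw.
(* The relation [p' * t = t' * p], carried to [B] and solved using that [iS p'] is an isometry and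
   [iS p] a coisometry. *)
have c : star (iS p') * iS t' = iS t * star (iS p).
  have := congr1 (fun z => star (iS p') * z * star (iS p)) (iS_mul hB t' p).
  rewrite -e (iS_mul hB) !mulrA (iS_isometry hB) mul1r => ->.
  by rewrite -[_ * iS p * _]mulrA (iS_coisometry hun hB) mulr1.
rewrite !(iS_mul hB) csM !mulrA -[star (iS s) * _ * _]mulrA c.
by rewrite !mulrA.
Qed.

Lemma ext_unitary g : star (w g) * w g = 1 /\ w g * star (w g) = 1.
Proof.
have [s [t ->]] := env_frac hG g; rewrite hw csM csK; split.
- rewrite !mulrA -[_ * iS s * _]mulrA (iS_coisometry hun hB) mulr1.
  exact: iS_isometry hB t.
- rewrite !mulrA -[_ * iS t * _]mulrA (iS_coisometry hun hB) mulr1.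
  exact: iS_isometry hB s.
Qed.

Lemma ext_conj g (d : D) :
  csub_incl (alphabarG hO hun hB hG g d) = w g * csub_incl d * star (w g).
Proof.
have [s [t ->]] := env_frac hG g; rewrite alphabarG_frac hw csM csK.
by rewrite /csub_incl /= !mulrA.
Qed.

End Extension.

Variables (C : cstarType R[i]) (iD : D -> C) (u : G -> C).
Hypothesis hC : is_group_crossed_product (alphabarG hO hun hB hG) iD u.

(** Generators of both crossed products are indexed by [A + S], so that [generated_iso] can match
    them. *)
Definition cp_gen (x : A + S) : B :=
  match x with inl a => iA a | inr s => iS s end.

Definition gcp_gen (x : A + S) : C :=
  match x with inl a => iD (iA_SAS a) | inr s => u (iota s) end.

Lemma cp_gen_generates : cstar_generates (range cp_gen).
Proof.
move=> E sE cE XE; apply: (cp_generates hB) => // x [] [y _ <-].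
- by apply: XE; exists (inl y).
- by apply: XE; exists (inr y).
Qed.

(** The automorphism of [s] carries [d] to [iA_SAS a]; covariance of [(iD, u)] undoes it by
    conjugation with [u (iota s)]. *)
Lemma iD_frac s a (d : D) : csub_incl d = star (iS s) * iA a * iS s ->
  iD d = star (u (iota s)) * iD (iA_SAS a) * u (iota s).
Proof.
move=> ds; have [uu _] := gcp_unitary hC (iota s).
have -> : iA_SAS a = alphabarG hO hun hB hG (iota s) d.
  rewrite alphabarG_iota; apply: csub_incl_inj.
  transitivity (iS s * csub_incl d * star (iS s)) => //.
  rewrite ds !mulrA (iS_coisometry hun hB) mul1r.
  by rewrite -mulrA (iS_coisometry hun hB) mulr1.
by rewrite (gcp_conj hC) !mulrA uu mul1r -mulrA uu mulr1.
Qed.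

(** Elements of [S*AS] are limits of elements [s* a s], whose images lie in [E] by [iD_frac]; [iD]
    is contractive, so it carries these limits into the closed set [E]. Fractions are handled by
    [u (s^-1 t) = star (u s) * u t]. *)
Lemma gcp_gen_generates : cstar_generates (range gcp_gen).
Proof.
move=> E sE cE XE; have [E1 El Em Es] := sE.
have EA a : E (iD (iA_SAS a)) by apply: XE; exists (inl a).
have ES s : E (u (iota s)) by apply: XE; exists (inr s).
apply: (gcp_generates hC) => // x [] [y _ <-].
- have [v Xv vy] := closure_cvs (csub_inclP y).
  have Ev n : SAS_set iA iS (v n) by exact: subset_closure (Xv n).
  pose y' n : D := @csub_mk R[i] B (SAS_subalg hO hun hB) _ (Ev n).
  apply: (@closed_cvs _ _ _ (fun n => iD (y' n))) => // [n|].
    have [s [a va]] := Xv n; rewrite (@iD_frac s a); last exact: va.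
    by apply: (Em) => //; apply: (Em) => //; exact: Es.
  have [lD _ _] := gcp_hom hC.
  apply: (@cvs_lip _ _ _ v (csub_incl y) 1) vy => n; rewrite mul1r.
  have -> : iD y - iD (y' n) = iD (y - y' n).
    have := lD (-1) (y' n) y; rewrite !scaleN1r => e.
    by rewrite [LHS]addrC -e; congr (iD _); exact: addrC.
  exact: star_hom_contractive (gcp_hom hC) (gcp_unital hC).
- have [s [t ->]] := env_frac hG y.
  have -> : u ((iota s)^-1 * iota t)%g = star (u (iota s)) * u (iota t).
    have [uu _] := gcp_unitary hC (iota s).
    by rewrite -[LHS]mul1r -uu -mulrA -(gcp_mul hC) mulVKg.
  by apply: (Em) => //; exact: Es.
Qed.

(** The restricted pair is covariant because [iA_SAS] intertwines [alpha] with [alphabarG]. *)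
Lemma cp_to_gcp : reps_transfer cp_gen gcp_gen.
Proof.
move=> H sigma rs.
have hD := gcp_hom hC.
have hf : is_star_hom (fun a => iD (iA_SAS a)).
  have [l m st] := hD; have [l' m' st'] := iA_SAS_hom.
  by split=> [k x y|x y|x]; rewrite ?l' ?m' ?st' ?l ?m ?st.
have [|rho [rr ra rS]] := cp_universal hB (pi := fun a => sigma (iD (iA_SAS a)))
  (V := fun s => sigma (u (iota s))).
  split.
  - by apply: (rep_comp rs hf); rewrite iA_SAS1 (gcp_unital hC).
  - by move=> t; apply: (rep_isometry rs); case: (gcp_unitary hC (iota t)).
  - by move=> s t x; rewrite (env_mul hG) (gcp_mul hC) (rep_mul rs).
  - move=> t; exists (sigma (star (u (iota t)))); first exact: rep_star.
    by move=> a x; rewrite iA_SAS_alpha (gcp_conj hC) !(rep_mul rs).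
by exists rho; split => // -[a|s] x; [exact: ra|exact: rS].
Qed.

(** The extension [w] of [iS] is unitary and implements [alphabarG], so [csub_incl] and [w] turn a
    representation of [B] into a covariant pair for [G]. *)
Lemma gcp_to_cp : reps_transfer gcp_gen cp_gen.
Proof.
move=> H sigma rs; have [w hw] := iS_group_ext.
have [|rho [rr rd rU]] := gcp_universal hC (pi := fun d => sigma (csub_incl d))
  (U := fun g => sigma (w g)).
  split.
  - exact: (rep_comp rs csub_incl_hom).
  - move=> g; have [w1 w2] := ext_unitary hw g; split.
      exact: rep_isometry.
    by move=> y; exists (sigma (star (w g)) y); rewrite -(rep_mul rs) w2 (rep_one rs).
  - by move=> g h x; rewrite (ext_mul hw) (rep_mul rs).
  - move=> g; exists (sigma (star (w g))); first exact: rep_star.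
    by move=> d x; rewrite (ext_conj hw) !(rep_mul rs).
exists rho; split => // -[a|s] x /=; first by rewrite rd.
by rewrite rU (ext_iota hw).
Qed.

End CrossedProducts.

Local Close Scope classical_set_scope.
Local Close Scope complex_scope.

Theorem corollary4p7 (R : realType) (A : cstarType R[i])
    (S : monoidType) (hS : cancellative S) (hO : left_ore S)
    (G : groupType) (iota : S -> G) (hG : is_enveloping_group iota)
    (alpha : S -> A -> A) (halpha : is_action alpha)
    (hinj : forall s, injective (alpha s)) (hun : unital_action alpha)
    (B : cstarType R[i]) (iA : A -> B) (iS : S -> B)
    (hB : is_crossed_product alpha iA iS)
    (C : cstarType R[i]) (iD : SAS hO hun hB -> C) (u : G -> C)
    (hC : is_group_crossed_product (alphabarG hO hun hB hG) iD u) :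
  exists Phi : B -> C,
    [/\ is_star_hom Phi, bijective Phi &
        forall s x, Phi (iS s * x * star (iS s)) =
                    u (iota s) * Phi x * star (u (iota s))].
Proof.
have [Phi [hPhi bij PhiE]] := generated_iso (@cp_gen_generates _ _ _ _ _ _ _ hB)
  (gcp_gen_generates hC) (cp_to_gcp hC) (gcp_to_cp hC).
have [_ PM PS] := hPhi; exists Phi; split => // s x.
(* Equivariance reduces to [Phi (iS s) = u (iota s)], the matching of generators at [inr s]. *)
by rewrite !PM PS -[iS s]/(cp_gen iA iS (inr s)) !PhiE.
Qed.
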